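(* Let $\mathcal{A}$ be a unital $C^{*}$-algebra, let $F,D\in B^{a}(H_{\mathcal{A}})$ and suppose that $\operatorname{Im}F$ and $\operatorname{Im}D$ are closed. If $\operatorname{Im}F+\ker D$ is closed, then $\operatorname{Im}F+\ker D$ is orthogonally complementable.
   Context: $H_{\mathcal{A}}=l_2(\mathcal{A})$ is the standard (right) Hilbert $C^{*}$-module over $\mathcal{A}$ of sequences $(a_i)_{i\in\mathbb{N}}$ in $\mathcal{A}$ with $\sum_i a_i^{*}a_i$ norm-convergent, and $B^{a}(H_{\mathcal{A}})$ is the set of bounded adjointable operators on it. A closed submodule $X$ is orthogonally complementable if $H_{\mathcal{A}}=X\oplus X^{\perp}$. *)

(* Defs.v *)
From HB Require Import structures.
From mathcomp Require Import all_boot all_order all_algebra complex.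
From mathcomp Require Import all_classical all_reals all_analysis.

Set Implicit Arguments.
Unset Strict Implicit.
Unset Printing Implicit Defensive.

Import Order.TTheory GRing.Theory Num.Theory.
Import numFieldNormedType.Exports.

Local Open Scope classical_set_scope.
Local Open Scope ring_scope.
Local Open Scope complex_scope.

(* Unital C*-algebras over the complex numbers R[i]. The ring operations are
   fields because the library hierarchy has no join of (semi)rings and normed
   modules below numDomainType. The zero algebra is allowed. *)
HB.mixin Record isCStarAlgebra (R : realType) A
    of CompleteNormedModule R[i] A := {
  cmul : A -> A -> A ;
  cone : A ;
  star : A -> A ;
  cmulA : associative cmul ;
  cmul1x : left_id cone cmul ;
  cmulx1 : right_id cone cmul ;
  cmulDl : left_distributive cmul +%R ;
  cmulDr : right_distributive cmul +%R ;
  cmulZl : forall (c : R[i]) (a b : A), cmul (c *: a) b = c *: cmul a b ;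
  cmulZr : forall (c : R[i]) (a b : A), cmul a (c *: b) = c *: cmul a b ;
  starD : forall a b : A, star (a + b) = star a + star b ;
  starZ : forall (c : R[i]) (a : A), star (c *: a) = Num.conj c *: star a ;
  starM : forall a b : A, star (cmul a b) = cmul (star b) (star a) ;
  starK : involutive star ;
  norm_cmul_le : forall a b : A, `|cmul a b| <= `|a| * `|b| ;
  norm_star_cmul : forall a : A, `|cmul (star a) a| = `|a| ^+ 2
}.

#[short(type="cstarAlgType")]
HB.structure Definition CStarAlgebra (R : realType) :=
  {A of CompleteNormedModule R[i] A & isCStarAlgebra R A}.

Section StandardModule.
Context {R : realType} {A : cstarAlgType R}.
Implicit Types (x y z : A ^nat) (M N X : set (A ^nat)).
Implicit Types F G : A ^nat -> A ^nat.

(* The carrier of l_2(A) is a set of sequences; the vector operations are the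
   pointwise ones of [A ^nat]. *)
Definition l2 : set (A ^nat) :=
  [set x | cvgn (series (fun i => cmul (star (x i)) (x i)))].

Definition l2_act x (a : A) : A ^nat := fun i => cmul (x i) a.

Definition l2_ip x y : A := limn (series (fun i => cmul (star (x i)) (y i))).

Definition l2_norm x : R[i] := sqrtC `|l2_ip x x|.

Definition l2_closed X :=
  forall x, l2 x ->
    (forall e : R[i], 0 < e -> exists2 y, X y & l2_norm (x - y) < e) -> X x.

(* Invariance under complex scalars follows since c *: x = l2_act x (c *: cone). *)
Definition l2_submodule X :=
  [/\ X `<=` l2, X 0, (forall x y, X x -> X y -> X (x + y)) &
      forall x a, X x -> X (l2_act x a)].

(* Operators on l_2(A) are functions on all sequences of which only the
   restriction to [l2] is relevant. *)
Definition l2_linear F :=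
  [/\ (forall x, l2 x -> l2 (F x)),
      (forall x y, l2 x -> l2 y -> F (x + y) = F x + F y) &
      forall x a, l2 x -> F (l2_act x a) = l2_act (F x) a].

Definition l2_bounded F :=
  exists2 C : R[i], 0 <= C & forall x, l2 x -> l2_norm (F x) <= C * l2_norm x.

Definition l2_adjoint F G :=
  (forall y, l2 y -> l2 (G y)) /\
  forall x y, l2 x -> l2 y -> l2_ip (F x) y = l2_ip x (G y).

Definition bounded_adjointable F :=
  [/\ l2_linear F, l2_bounded F & exists G, l2_adjoint F G].

Definition l2_im F : set (A ^nat) := F @` l2.

Definition l2_ker F : set (A ^nat) := [set x | l2 x /\ F x = 0].

Definition l2_sum M N : set (A ^nat) := [set x + y | x in M & y in N].

Definition l2_orth X : set (A ^nat) :=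
  [set y | l2 y /\ forall x, X x -> l2_ip x y = 0].

Definition orthogonally_complementable X :=
  [/\ l2_submodule X, l2_closed X, l2_sum X (l2_orth X) = l2 &
      X `&` l2_orth X = [set 0]].

End StandardModule.

Arguments l2 {R} A.

(* Main.v *)
(* Closed ranges of adjointable operators are complemented (Mishchenko), and so
   are their kernels. Let P be the projection onto the orthogonal complement K'
   of K = ker D. Then Im F + K is the orthogonal sum of K and Im (P F), and
   Im (P F) is the intersection of Im F + K with K', hence closed and therefore
   complemented.

   Let T be adjointable with adjoint G and closed range M. By the uniform
   boundedness principle G is bounded below on M, so |(T G + t) w| >= c |w| on M
   for all t >= 0, and the surjectivity of T G + t on M propagates from large t
   down to t = 0. Solving T G w = T G z with w in M gives z - w orthogonal to M.

   The order of the C*-algebra is obtained without spectral theory: a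
   self-adjoint a counts as positive when |t - a| <= t for some real t. *)

From HB Require Import structures.
Require Import Defs.
From mathcomp Require Import all_boot all_order all_algebra complex.
From mathcomp Require Import all_classical all_reals all_analysis.
From mathcomp Require Import ring lra.

Set Implicit Arguments.
Unset Strict Implicit.
Unset Printing Implicit Defensive.

Import Order.TTheory GRing.Theory Num.Theory.
Import numFieldNormedType.Exports.

Local Open Scope classical_set_scope.
Local Open Scope ring_scope.
Local Open Scope complex_scope.

(** A closed submodule of a Hilbert module need not have a complement, so complements must come from
    solving operator equations. Every norm estimate on the module rests on the Cauchy-Schwarz
    inequality and on |a| <= |a + b| for positive a and b, and the former needs the positivity of x'
    x, where x' = star x; hence the amount of elementary order theory. The passage from Im (P F) to
    Im F + K works as follows: if z = P F x + u with u orthogonal to Im (P F), then P u is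
    orthogonal to Im F + K, because P is self-adjoint and vanishes on K, while z - P u = P F x + (u
    - P u) lies in Im F + K. *)

Section RingInstance.
Variables (R : realType) (A : cstarAlgType R).
(** The ring may be zero because the zero algebra is allowed; this is also why [nm1_le1] and
    [nm_cst] are only inequalities. *)
#[non_forgetful_inheritance]
HB.instance Definition _ := GRing.Zmodule_isPzRing.Build A (@cmulA R A)
  (@cmul1x R A) (@cmulx1 R A) (@cmulDl R A) (@cmulDr R A).
End RingInstance.

(** * The norm as a real number, and scalars inside the algebra *)

Section Basics.
Variables (R : realType) (A : cstarAlgType R).
Implicit Types (a b x y z h : A) (t s r : R).

Lemma cmulE a b : cmul a b = a * b. Proof. by []. Qed.

Lemma scaleAl (c : R[i]) a b : (c *: a) * b = c *: (a * b).
Proof. exact: cmulZl. Qed.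
Lemma scaleAr (c : R[i]) a b : a * (c *: b) = c *: (a * b).
Proof. exact: cmulZr. Qed.

Lemma star0 : star 0 = 0 :> A.
Proof. by apply: (addrI (star 0)); rewrite -starD !addr0. Qed.
Lemma starN a : star (- a) = - star a.
Proof. by apply: (addrI (star a)); rewrite -starD !subrr star0. Qed.
Lemma starB a b : star (a - b) = star a - star b.
Proof. by rewrite starD starN. Qed.
Lemma starMr a b : star (a * b) = star b * star a.
Proof. exact: starM. Qed.
Lemma star1 : star 1 = 1 :> A.
Proof. by have := starMr 1 (star 1); rewrite mul1r starK mul1r. Qed.
Lemma star_sum (I : Type) (s : seq I) (P : pred I) (u : I -> A) :
  star (\sum_(i <- s | P i) u i) = \sum_(i <- s | P i) star (u i).
Proof. exact: (big_morph _ starD star0). Qed.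

(** The norm takes values in [R[i]]; its real part allows estimates in the ordered field [R]. *)
Definition nm a : R := complex.Re `|a|.

Lemma normE a : `|a| = (nm a)%:C.
Proof. by rewrite /nm RRe_real// normr_real. Qed.

Lemma nm_ge0 a : 0 <= nm a.
Proof. by rewrite -lecR -normE normr_ge0. Qed.
Lemma nmD a b : nm (a + b) <= nm a + nm b.
Proof. by rewrite -lecR rmorphD/= -!normE ler_normD. Qed.
Lemma nmN a : nm (- a) = nm a.
Proof. by rewrite /nm normrN. Qed.
Lemma nmB a b : nm (a - b) <= nm a + nm b.
Proof. by rewrite -(nmN b) nmD. Qed.
Lemma nmC a b : nm (a - b) = nm (b - a).
Proof. by rewrite -nmN opprB. Qed.
Lemma nmM a b : nm (a * b) <= nm a * nm b.
Proof. by rewrite -lecR rmorphM/= -!normE norm_cmul_le. Qed.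
Lemma nm0 : nm 0 = 0.
Proof. by rewrite /nm normr0. Qed.
Lemma nm0_eq0 a : nm a = 0 -> a = 0.
Proof. by move=> h; apply: normr0_eq0; rewrite normE h. Qed.
Lemma nm_le0 a : nm a <= 0 -> a = 0.
Proof. by move=> h; apply: nm0_eq0; apply: le_anti; rewrite h nm_ge0. Qed.
Lemma nm_starM a : nm (star a * a) = nm a ^+ 2.
Proof.
by apply: (@complexI R); rewrite rmorphXn/= -!normE norm_star_cmul.
Qed.
(** |b|^2 = |b' b| <= |b'| |b|, and |b| cancels. *)
Lemma nm_star a : nm (star a) = nm a.
Proof.
suff le b : nm b <= nm (star b).
  by apply: le_anti; rewrite le// -{2}(starK a) le.
have [->|b0] := eqVneq (nm b) 0; first exact: nm_ge0.
have bp : 0 < nm b by rewrite lt_neqAle eq_sym b0 nm_ge0.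
by rewrite -(ler_pM2r bp) -expr2 -nm_starM nmM.
Qed.
Lemma nm_sa a : star a = a -> nm (a * a) = nm a ^+ 2.
Proof. by move=> {1}<-; rewrite nm_starM. Qed.

(** Real scalars and the imaginary unit become central elements of [A], which keeps the computations
    inside the ring. *)
Definition cst t : A := t%:C *: (1 : A).
Definition ii : A := 'i%C *: (1 : A).

Lemma cstC t a : cst t * a = a * cst t.
Proof. by rewrite /cst scaleAl scaleAr mul1r mulr1. Qed.
Lemma cstE t a : cst t * a = t%:C *: a.
Proof. by rewrite /cst scaleAl mul1r. Qed.
Lemma cst1 : cst 1 = 1.
Proof. by rewrite /cst scale1r. Qed.
Lemma cst0 : cst 0 = 0.
Proof. by rewrite /cst scale0r. Qed.
Lemma cstD t s : cst (t + s) = cst t + cst s.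
Proof. by rewrite /cst rmorphD/= scalerDl. Qed.
Lemma cstN t : cst (- t) = - cst t.
Proof. by rewrite /cst rmorphN/= scaleNr. Qed.
Lemma cstB t s : cst (t - s) = cst t - cst s.
Proof. by rewrite cstD cstN. Qed.
Lemma cstM t s : cst (t * s) = cst t * cst s.
Proof. by rewrite cstE /cst rmorphM/= scalerA. Qed.
Lemma cst_star t : star (cst t) = cst t.
Proof.
rewrite /cst starZ star1; congr (_ *: _).
by apply/eqP; rewrite eq_complex/= oppr0 !eqxx.
Qed.
Lemma nm_cstM t a : nm (cst t * a) = `|t| * nm a.
Proof.
apply: (@complexI R); rewrite cstE -normE normrZ rmorphM/= -normE.
by congr (_ * _); rewrite normc_def/= expr0n addr0 sqrtr_sqr.
Qed.
Lemma nm1_le1 : nm 1 <= 1.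
Proof.
have := nm_sa star1; rewrite mulr1 => h.
have [//|lt1] := leP (nm 1) 1.
have : nm 1 < nm 1 ^+ 2 by rewrite expr2 ltr_pMr// (lt_trans ltr01).
by rewrite -h ltxx.
Qed.
Lemma nm_cst t : nm (cst t) <= `|t|.
Proof. by rewrite -[cst t]mulr1 nm_cstM ler_piMr// nm1_le1. Qed.

Lemma iiC a : ii * a = a * ii.
Proof. by rewrite /ii scaleAl scaleAr mul1r mulr1. Qed.
Lemma iiK a : ii * (ii * a) = - a.
Proof.
rewrite /ii !scaleAl !mul1r scalerA.
have -> : ('i * 'i : R[i])%C = -1.
  by rewrite -expr2 sqr_i.
by rewrite scaleN1r.
Qed.
Lemma ii_star : star ii = - ii.
Proof.
rewrite /ii starZ star1 -scaleNr; congr (_ *: _).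
by apply/eqP; rewrite eq_complex/= oppr0 !eqxx.
Qed.

Lemma cvg_nm (u : nat -> A) (l : A) :
  (u @ \oo --> l) <-> (forall e : R, 0 < e -> \forall n \near \oo, nm (l - u n) < e).
Proof.
split.
  move=> /cvgrPdist_lt ul e e0.
  have := ul e%:C; rewrite ltcR => /(_ e0).
  by apply: filterS => n; rewrite normE ltcR.
move=> ul; apply/cvgrPdist_lt => e e0.
have er : e = (complex.Re e)%:C by rewrite RRe_real// gtr0_real.
have := ul (complex.Re e); rewrite -ltcR -er => /(_ e0).
by apply: filterS => n; rewrite -ltcR -er -normE.
Qed.

Lemma cvg_cauchy_nm (u : nat -> A) :
  (forall e : R, 0 < e -> exists N, forall m n, (N <= m)%N -> (N <= n)%N ->
    nm (u m - u n) < e) -> cvgn u.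
Proof.
move=> H; apply: cauchy_cvg; apply/cauchy_ballP => e e0.
have er : e = (complex.Re e)%:C by rewrite RRe_real// gtr0_real.
have re0 : 0 < complex.Re e by rewrite -ltcR -er.
have [N HN] := H _ re0.
pose U := u @` [set n | (N <= n)%N].
have nU : nbhs (u @ \oo) U by exists N => // n /= Nn; exists n.
exists (U, U) => // -[_ _] /= [[m Nm <-] [n Nn <-]].
by rewrite -ball_normE/= normE er ltcR; exact: HN.
Qed.
End Basics.

(** * Squares of self-adjoint elements *)

Section Positivity.
Variables (R : realType) (A : cstarAlgType R).
Implicit Types (a b x y z h : A) (t s r : R).
Local Notation cst := (@cst R A).
Local Notation ii := (ii A).

Lemma cvg_mul (u v : nat -> A) a b :
  u @ \oo --> a -> v @ \oo --> b -> (fun n => u n * v n) @ \oo --> a * b.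
Proof.
move=> /cvg_nm ua /cvg_nm vb; apply/cvg_nm => e e0.
pose K := nm a + nm b + 1.
have K0 : 0 < K by rewrite /K ltr_wpDl// addr_ge0 ?nm_ge0.
(* [d <= 1] gives |u n| <= |a| + 1, so the error is at most [d * K], which is less than
   [d * (2 * K) <= e]. *)
pose d := Num.min 1 (e / (2 * K)).
have d0 : 0 < d by rewrite lt_min ltr01 divr_gt0// mulr_gt0.
have d1 : d <= 1 by rewrite ge_min lexx.
have de : d * (2 * K) <= e.
  by rewrite -ler_pdivlMr ?mulr_gt0// ge_min lexx orbT.
near=> n.
have una : nm (a - u n) < d by near: n; exact: ua.
have vnb : nm (b - v n) < d by near: n; exact: vb.
have -> : a * b - u n * v n = (a - u n) * b + u n * (b - v n).
  by rewrite mulrBl mulrBr addrA subrK.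
have un : nm (u n) <= nm a + 1.
  rewrite -[u n](subKr a) (le_trans (nmB _ _))// lerD2l.
  by rewrite (le_trans (ltW una)).
apply: (le_lt_trans (nmD _ _)); apply: (@le_lt_trans _ _ (d * K)).
  have -> : d * K = d * nm b + d * (nm a + 1) by rewrite /K; ring.
  rewrite lerD//.
    by rewrite (le_trans (nmM _ _))// ler_wpM2r ?nm_ge0// ltW.
  by rewrite (le_trans (nmM _ _))// mulrC ler_pM ?nm_ge0// ltW.
apply: lt_le_trans de; rewrite mulrCA ltr_pMl ?mulr_gt0//.
by rewrite ltr1n.
Unshelve. all: by end_near.
Qed.

Lemma cvg_star (u : nat -> A) a :
  u @ \oo --> a -> (fun n => star (u n)) @ \oo --> star a.
Proof.
move=> /cvg_nm ua; apply/cvg_nm => e e0.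
by near=> n; rewrite -starB nm_star; near: n; exact: ua.
Unshelve. all: by end_near.
Qed.

Lemma cvg_nm_le (u : nat -> A) a t :
  u @ \oo --> a -> (\forall n \near \oo, nm (u n) <= t) -> nm a <= t.
Proof.
move=> /cvg_nm ua ut; apply/ler_addgt0Pr => e e0.
near \oo => n.
rewrite -[a](subrK (u n)) (le_trans (nmD _ _))// addrC lerD//.
  by near: n.
by apply: ltW; near: n; exact: ua.
Unshelve. all: by end_near.
Qed.

Lemma cvg_uniq (u : nat -> A) a b : u @ \oo --> a -> u @ \oo --> b -> a = b.
Proof. by move=> ua ub; apply: (cvg_unique _ ua ub); exact: norm_hausdorff. Qed.

(* [y + i h y] and [y - i h y] have the same norm by the C*-identity, and
   [y] is their mean. *)
Lemma nm_le_addii h y : star h = h -> nm y <= nm (y + ii * (h * y)).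
Proof.
move=> hs.
have E : nm (y - ii * (h * y)) = nm (y + ii * (h * y)).
  apply/eqP; rewrite -(@eqrXn2 _ 2) ?nm_ge0// -!nm_starM; apply/eqP.
  congr nm; rewrite starB starD !starMr hs ii_star !mulrN opprK.
  rewrite !(mulrDl, mulrDr, mulrBl, mulrBr, mulNr, mulrN).
  have H : star y * (ii * (h * y)) = star y * h * ii * y.
    by rewrite !mulrA -(mulrA (star y) ii) (iiC h) !mulrA.
  rewrite H; set u := star y * y; set v := _ * h * _ * y; set w := _ * _.
  by rewrite addrA subrK addrA addrK.
have : nm (y + y) <= nm (y + ii * (h * y)) + nm (y + ii * (h * y)).
  rewrite -{2}E; apply: le_trans (nmD _ _).
  by rewrite addrACA subrr addr0.
have -> : y + y = cst 2 * y.
  by rewrite (_ : 2 = 1 + 1)// cstD cst1 mulrDl mul1r.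
by rewrite nm_cstM ger0_norm//; lra.
Qed.

(** 1 + h^2 = (1 - i h) (1 + i h), and left multiplication by either factor is expanding by
    [nm_le_addii]. *)
Lemma nm_le_addsq h y : star h = h -> nm y <= nm (y + h * (h * y)).
Proof.
move=> hs; apply: le_trans (nm_le_addii y hs) _.
have hs' : star (- h) = - h by rewrite starN hs.
apply: le_trans (nm_le_addii _ hs') _.
rewrite le_eqVlt; apply/orP; left; apply/eqP; congr nm; rewrite -addrA; congr (_ + _).
rewrite mulNr mulrN !mulrDr !opprD addrA subrr add0r.
by rewrite (mulrA h ii) -(iiC h) -mulrA iiK opprK.
Qed.

(** The exponents 2^n suit the repeated squaring in [nm_1Bsq]. *)
Lemma pow_small (q e : R) : 0 <= q -> q < 1 -> 0 < e -> exists n, q ^+ (2 ^ n) < e.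
Proof.
move=> q0 q1 e0.
have /cvgrPdist_lt/(_ _ e0) : (fun n : nat => q ^+ n) @ \oo --> (0 : R).
  by apply: cvg_expr; rewrite ger0_norm.
move=> [N _ HN]; exists N; have := HN (2 ^ N)%N.
rewrite /= sub0r normrN ger0_norm ?exprn_ge0//; apply.
by rewrite ltnW// ltn_expl.
Qed.

Lemma nm_exp a n : nm (a ^+ n.+1) <= nm a ^+ n.+1.
Proof.
elim: n => [|n IH]; first by rewrite !expr1.
by rewrite exprS [leRHS]exprS (le_trans (nmM _ _))// ler_wpM2l ?nm_ge0.
Qed.

Lemma star_exp a n : star (a ^+ n) = star a ^+ n.
Proof.
by elim: n => [|n IH]; rewrite ?expr0 ?star1// exprS starMr IH -exprSr.
Qed.

(* [(1 + h^2) (1 - h^2) = 1 - h^4] and left multiplication by [1 + h^2] is expanding. *)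
Lemma nm_1Bsq h : star h = h -> nm h < 1 -> nm (1 - h * h) <= 1.
Proof.
move=> hs h1.
suff H n : nm (1 - h * h) <= 1 + nm h ^+ (2 ^ n).
  apply/ler_addgt0Pr => e e0.
  have [n hn] := pow_small (nm_ge0 h) h1 e0.
  by rewrite (le_trans (H n))// lerD2l ltW.
apply: (@le_trans _ _ (nm (1 - h ^+ (2 ^ n.+1)))).
  elim: n => [|n IH]; first by rewrite expn1 expr2.
  apply: (le_trans IH).
  have ks' : star (h ^+ (2 ^ n)) = h ^+ (2 ^ n) by rewrite star_exp hs.
  have e1 : h ^+ (2 ^ n.+1) = h ^+ (2 ^ n) * h ^+ (2 ^ n).
    by rewrite -exprD addnn -mul2n expnS.
  have e2 : h ^+ (2 ^ n.+2) = h ^+ (2 ^ n.+1) * h ^+ (2 ^ n.+1).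
    by rewrite -exprD addnn -mul2n expnS.
  apply: le_trans (nm_le_addsq _ ks') _.
  rewrite mulrA -e1 mulrBr mulr1 -e2 addrA subrK//.
have : (0 < 2 ^ n.+1)%N by rewrite expn_gt0.
move=> p; rewrite (le_trans (nmB _ _))// lerD ?nm1_le1//.
rewrite -(prednK p) (le_trans (nm_exp _ _))// prednK//.
by rewrite ler_wiXn2l ?nm_ge0 ?ltW// leq_exp2l.
Qed.

Lemma nm_cstBsq h t : star h = h -> nm h ^+ 2 <= t -> nm (cst t - h * h) <= t.
Proof.
move=> hs ht; have t0 : 0 <= t by rewrite (le_trans _ ht)// exprn_ge0// nm_ge0.
(* For s > t the rescaled element h / sqrt s has norm less than 1, as [nm_1Bsq] requires; t itself
   is reached as a limit. *)
suff H s : t < s -> nm (cst s - h * h) <= s.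
  apply/ler_addgt0Pr => e e0; have e2 : 0 < e / 2 by rewrite divr_gt0.
  have -> : cst t - h * h = (cst (t + e / 2) - h * h) - cst (e / 2).
    by rewrite cstD (addrAC _ (cst (e / 2))) addrK.
  rewrite (le_trans (nmB _ _))//.
  have he := nm_cst A (e / 2); rewrite (ger0_norm (ltW e2)) in he.
  have := H (t + e / 2); rewrite ltrDl => /(_ e2) H2.
  by rewrite (le_trans (lerD H2 he))// -addrA -splitr.
move=> ts; have s0 : 0 < s by exact: le_lt_trans ts.
have q0 : 0 < Num.sqrt s by rewrite sqrtr_gt0.
pose k := cst (Num.sqrt s)^-1 * h.
have ks : star k = k by rewrite /k starMr cst_star hs cstC.
have k1 : nm k < 1.
  rewrite nm_cstM ger0_norm ?invr_ge0 ?(ltW q0)// mulrC ltr_pdivrMr// mul1r.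
  by rewrite -(@ltr_pXn2r _ 2) ?nnegrE ?nm_ge0 ?sqrtr_ge0// sqr_sqrtr ?(ltW s0)// (le_lt_trans ht).
have -> : cst s - h * h = cst s * (1 - k * k).
  rewrite mulrBr mulr1; congr (_ - _).
  rewrite /k mulrA -(mulrA _ h) -cstC !mulrA -!cstM.
  rewrite -{1}(@sqr_sqrtr _ s) ?(ltW s0)// expr2 mulrK ?divff ?cst1 ?mul1r//.
    by rewrite gt_eqF.
  by rewrite unitfE gt_eqF.
by rewrite nm_cstM (ger0_norm (ltW s0)) -[leRHS]mulr1 ler_wpM2l ?(ltW s0)// nm_1Bsq.
Qed.
End Positivity.

(** * Square roots of 1 - x by iteration *)

Section SquareRoot.
Variables (R : realType) (A : cstarAlgType R).
Implicit Types (a b x y z h k : A) (t s r : R).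
Local Notation cst := (@cst R A).

Lemma commr_cst z t : GRing.comm z (cst t).
Proof. by rewrite /GRing.comm cstC. Qed.

(** A fixed point l of y = (x + y^2) / 2 satisfies (1 - l)^2 = 1 - x. [sqrt_bnd] is the scalar
    iteration for x = 1, which increases and stays at most 1; for |x| <= 1 it majorizes the
    iterates, and its increments majorize theirs. *)
Let sqrt_seq x n : A := iter n (fun y => cst 2^-1 * (x + y * y)) 0.
Let sqrt_bnd n : R := iter n (fun w => (1 + w * w) / 2) 0.

Lemma sqrt_seqS x n :
  sqrt_seq x n.+1 = cst 2^-1 * (x + sqrt_seq x n * sqrt_seq x n).
Proof. by []. Qed.

Lemma sqrt_bndP n : 0 <= sqrt_bnd n <= 1 /\ sqrt_bnd n <= sqrt_bnd n.+1.
Proof.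
elim: n => [|n [/andP[h0 h1] h2]].
  by split; rewrite /sqrt_bnd/= ?lexx ?ler01//; lra.
have E m : sqrt_bnd m.+1 = (1 + sqrt_bnd m * sqrt_bnd m) / 2 by [].
split; last by rewrite (E n.+1) {1}(E n); nra.
by rewrite (E n); apply/andP; split; nra.
Qed.

Lemma sqrt_seqC x z n : GRing.comm z x -> GRing.comm z (sqrt_seq x n).
Proof.
move=> zx; elim: n => [|n IH]; first exact: commr0.
rewrite sqrt_seqS.
by apply: commrM; [exact: commr_cst|apply: commrD => //; exact: commrM].
Qed.

Lemma sqrt_seq_star x n : star x = x -> star (sqrt_seq x n) = sqrt_seq x n.
Proof.
move=> xs; elim: n => [|n IH]; first exact: star0.
rewrite sqrt_seqS.
by rewrite starMr starD starMr IH xs cst_star cstC.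
Qed.

(** Consecutive iterates u, v commute, so u^2 - v^2 = (u - v) (u + v), and the recursion for the
    increments is dominated by the scalar one. *)
Lemma sqrt_seq_bnd x n : nm x <= 1 -> nm (sqrt_seq x n) <= sqrt_bnd n /\
  nm (sqrt_seq x n.+1 - sqrt_seq x n) <= sqrt_bnd n.+1 - sqrt_bnd n.
Proof.
move=> x1.
have h2 : `|2^-1| = 2^-1 :> R by rewrite ger0_norm// invr_ge0.
have E := sqrt_seqS x.
have Eb m : sqrt_bnd m.+1 = (1 + sqrt_bnd m * sqrt_bnd m) / 2 by [].
elim: n => [|n [IH1 IH2]].
  split; first by rewrite nm0.
  rewrite E Eb /sqrt_bnd/= subr0 mulr0 addr0 nm_cstM h2; lra.
have [/andP[b0 b1] bb] := sqrt_bndP n.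
have N0 := nm_ge0 (sqrt_seq x n).
have F : nm (sqrt_seq x n.+1) <= sqrt_bnd n.+1.
  have H1 := nmM (sqrt_seq x n) (sqrt_seq x n).
  have H2 := nmD x (sqrt_seq x n * sqrt_seq x n).
  by rewrite E nm_cstM h2 Eb; nra.
split => //.
have C : GRing.comm (sqrt_seq x n) (sqrt_seq x n.+1).
  by apply: sqrt_seqC; apply/commr_sym/sqrt_seqC.
rewrite E {1}E -mulrBr opprD addrACA subrr add0r.
set u := sqrt_seq x n.+1 in C F IH2 *; set v := sqrt_seq x n in C IH1 IH2 N0 *.
have -> : u * u - v * v = (u - v) * (u + v).
  by rewrite mulrDr !mulrBl C addrA subrK.
rewrite nm_cstM h2.
have H1 := nmM (u - v) (u + v); have H2 := nmD u v.
have H3 := nm_ge0 (u + v); have H4 := nm_ge0 (u - v).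
rewrite (Eb n.+1) {3}(Eb n).
apply: (@le_trans _ _ (2^-1 * ((sqrt_bnd n.+1 - sqrt_bnd n) * (sqrt_bnd n.+1 + sqrt_bnd n)))).
  rewrite ler_wpM2l ?invr_ge0// (le_trans H1)// ler_pM// (le_trans H2)// lerD//.
lra.
Qed.

(** The bound |1 - k| <= 1 makes the root itself positive, and commutation passes from the iterates
    to the limit; [pos_sqrt] relies on both. *)
Lemma sqrt_1B x : star x = x -> nm x <= 1 -> exists k,
  [/\ star k = k, k * k = 1 - x, nm (1 - k) <= 1 &
      forall z, GRing.comm z x -> GRing.comm z k].
Proof.
move=> xs x1.
have bb n m : (n <= m)%N -> sqrt_bnd n <= sqrt_bnd m.
  elim: m => [|m IH]; first by rewrite leqn0 => /eqP->.
  rewrite leq_eqVlt => /orP[/eqP->//|/IH h].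
  by apply: le_trans h _; have [] := sqrt_bndP m.
have D n m : (n <= m)%N ->
    nm (sqrt_seq x m - sqrt_seq x n) <= sqrt_bnd m - sqrt_bnd n.
  elim: m => [|m IH]; first by rewrite leqn0 => /eqP->; rewrite !subrr nm0.
  rewrite leq_eqVlt => /orP[/eqP->|/IH h]; first by rewrite !subrr nm0.
  have [_ h'] := sqrt_seq_bnd m x1.
  rewrite -(subrK (sqrt_seq x m) (sqrt_seq x m.+1)) -addrA.
  by rewrite (le_trans (nmD _ _))//; lra.
have cw : cvgn sqrt_bnd.
  apply: nondecreasing_is_cvgn; first by move=> n m; exact: bb.
  by exists 1 => _ [n _ <-]; have [/andP[]] := sqrt_bndP n.
have /cvg_ex[/= l Yl] : cvgn (sqrt_seq x).
  apply: cvg_cauchy_nm => e e0.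
  move/cvgrPdist_lt : (cw) => /(_ (e / 2)); rewrite divr_gt0// => /(_ isT) [N _ HN].
  exists N => m n Nm Nn.
  wlog mn : m n Nm Nn / (n <= m)%N.
    move=> W; have /orP[nm'|nm'] := leq_total n m; first exact: W.
    by rewrite nmC; exact: W.
  apply: le_lt_trans (D _ _ mn) _.
  have := HN m Nm; have := HN n Nn; rewrite /= !ltr_norml => /andP[a1 a2] /andP[a3 a4].
  lra.
have ls : star l = l.
  apply: cvg_uniq (cvg_star Yl) _.
  by under eq_fun do rewrite sqrt_seq_star//.
have lx : l = cst 2^-1 * (x + l * l).
  have Yl1 : (fun n => sqrt_seq x n.+1) @ \oo --> l by rewrite cvg_shiftS.
  apply: cvg_uniq Yl1 _; apply: cvg_mul; first exact: cvg_cst.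
  by apply: cvgD; [exact: cvg_cst|exact: cvg_mul].
exists (1 - l); split.
- by rewrite starB star1 ls.
- have l2 : l + l = x + l * l.
    rewrite {1 2}lx -mulrDl -cstD (_ : _ + _ = 1) ?cst1 ?mul1r//; lra.
  have -> : x = l + l - l * l by rewrite l2 addrK.
  by rewrite mulrBl !mulrBr !mul1r mulr1 -addrA -opprD addrA.
- rewrite subKr; apply: cvg_nm_le Yl _; exists 0%N => // n _.
  have [h _] := sqrt_seq_bnd n x1; have [/andP[_ h'] _] := sqrt_bndP n.
  exact: le_trans h h'.
- move=> z zx; apply: commrB; first exact: commr1.
  apply: (@cvg_uniq _ _ (fun n => z * sqrt_seq x n)).
    by apply: cvg_mul => //; exact: cvg_cst.
  have -> : (fun n => z * sqrt_seq x n) = (fun n => sqrt_seq x n * z).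
    by apply/funext => n; exact: sqrt_seqC.
  by apply: cvg_mul => //; exact: cvg_cst.
Qed.
End SquareRoot.

(** * Positive elements *)

Section Positive.
Variables (R : realType) (A : cstarAlgType R).
Implicit Types (a b p q x y z h k : A) (t s r : R).
Local Notation cst := (@cst R A).
Local Notation ii := (ii A).

(** For self-adjoint a the inequality says that the spectrum lies in [0, 2 t]. With t existential,
    sums are immediate: the bounds add. *)
Definition pos a := star a = a /\ exists t : R, nm (cst t - a) <= t.

Lemma pos_sq h : star h = h -> pos (h * h).
Proof.
move=> hs; split; first by rewrite starMr hs.
by exists (nm h ^+ 2); rewrite nm_cstBsq.
Qed.

Lemma posD a b : pos a -> pos b -> pos (a + b).
Proof.
move=> [as_ [t ht]] [bs [s hs]]; split; first by rewrite starD as_ bs.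
exists (t + s); rewrite cstD opprD addrACA.
by rewrite (le_trans (nmD _ _))// lerD.
Qed.

Lemma pos_cstM t a : 0 <= t -> pos a -> pos (cst t * a).
Proof.
move=> t0 [as_ [s hs]]; split; first by rewrite starMr cst_star as_ cstC.
by exists (t * s); rewrite cstM -mulrBr nm_cstM (ger0_norm t0) ler_wpM2l.
Qed.

(** Write a = t (1 - x) with x = (t - a) / t, so that |x| <= 1, and use [sqrt_1B]; t = 0 forces a =
    0. The commutation clause stands in for the functional calculus. *)
Lemma pos_sqrt a : pos a -> exists k,
  [/\ pos k, k * k = a & forall z, GRing.comm z a -> GRing.comm z k].
Proof.
move=> [as_ [t ht]].
have := le_trans (nm_ge0 _) ht; rewrite le_eqVlt => /predU1P[t0|t0].
  have -> : a = 0.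
    by apply: nm_le0; move: ht; rewrite -t0 cst0 sub0r nmN.
  exists 0; split; [|exact: mulr0|by move=> z _; exact: commr0].
  by split; [exact: star0|exists 0; rewrite cst0 subrr nm0].
have tn : t != 0 by rewrite gt_eqF.
have xs : star (cst t^-1 * (cst t - a)) = cst t^-1 * (cst t - a).
  by rewrite starMr starB as_ !cst_star cstC.
have x1 : nm (cst t^-1 * (cst t - a)) <= 1.
  rewrite nm_cstM ger0_norm ?invr_ge0 ?(ltW t0)//.
  by rewrite mulrC ler_pdivrMr// mul1r.
have [k0 [ks kk k1 kc]] := sqrt_1B xs x1.
have q0 : 0 <= Num.sqrt t by rewrite sqrtr_ge0.
exists (cst (Num.sqrt t) * k0); split.
- split; first by rewrite starMr cst_star ks cstC.
  exists (Num.sqrt t); rewrite -[X in X - _]mulr1 -mulrBr nm_cstM ger0_norm//.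
  by rewrite -[leRHS]mulr1 ler_wpM2l.
- rewrite mulrA -(mulrA _ k0) -cstC !mulrA -!cstM -expr2 sqr_sqrtr ?(ltW t0)//.
  rewrite -mulrA kk mulrBr mulr1 mulrA -cstM mulfV// cst1 mul1r.
  by rewrite opprB addrC subrK.
- move=> z za; apply: commrM; first exact: commr_cst.
  apply: kc; apply: commrM; first exact: commr_cst.
  by apply: commrB => //; exact: commr_cst.
Qed.

Lemma pos_star a : pos a -> star a = a. Proof. by case. Qed.

(** With a = k^2 we have |k|^2 = |a|, and [nm_cstBsq] applies. So every t >= |a| serves in [pos],
    not only the given witness. *)
Lemma pos_nm a t : pos a -> nm a <= t -> nm (cst t - a) <= t.
Proof.
move=> pa ta; have [k [pk kk _]] := pos_sqrt pa.
have ks := pos_star pk.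
by rewrite -kk nm_cstBsq// -nm_sa// kk.
Qed.

Lemma pos_cstB a t : star a = a -> nm a <= t -> pos (cst t - a).
Proof.
move=> as_ at_; split; first by rewrite starB cst_star as_.
by exists t; rewrite subKr.
Qed.

Lemma pos0 : pos 0.
Proof. by split; [exact: star0|exists 0; rewrite cst0 subrr nm0]. Qed.

Lemma pos_sum (I : Type) (s : seq I) (P : pred I) (u : I -> A) :
  (forall i, P i -> pos (u i)) -> pos (\sum_(i <- s | P i) u i).
Proof. by move=> H; elim/big_rec: _ => [|i v Pi pv]; [exact: pos0|apply: posD; [exact: H|]]. Qed.

(** The roots h of a and k of b commute, so h + i k and h - i k both have squared norm |a + b| by
    the C*-identity. Their mean is h, and |h|^2 = |a|. *)
Lemma pos_le_nmD_comm a b : pos a -> pos b -> GRing.comm a b ->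
  nm a <= nm (a + b).
Proof.
move=> pa pb ab.
have [h [ph hh hc]] := pos_sqrt pa; have [k [pk kk kc]] := pos_sqrt pb.
have hs := pos_star ph; have ks := pos_star pk.
have hk : h * k = k * h.
  by apply: kc; apply: commr_sym; apply: hc; apply: commr_sym.
have E (e : A) : e = ii \/ e = - ii -> star (h + e * k) * (h + e * k) = a + b.
  move=> He.
  have es : star e = - e by case: He => ->; rewrite ?starN ii_star// opprK.
  have eC z : e * z = z * e by case: He => ->; rewrite ?mulNr ?mulrN iiC.
  have ee z : e * (e * z) = - z.
    by case: He => ->; rewrite ?mulNr ?mulrN ?opprK iiK.
  rewrite starD starMr hs ks es mulrN -eC mulrBl !mulrDr -hh -kk.
  have -> : e * k * h = h * (e * k) by rewrite -mulrA -hk mulrA eC mulrA.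
  have -> : e * k * (e * k) = - (k * k) 
    by rewrite -mulrA (mulrA k) -eC -mulrA ee.
  by rewrite opprD opprK addrA addrK.
have N (e : A) : e = ii \/ e = - ii -> nm (h + e * k) ^+ 2 = nm (a + b).
  by move=> He; rewrite -nm_starM E.
have : nm (h + ii * k) = nm (h + - ii * k).
  by apply/eqP; rewrite -(@eqrXn2 _ 2) ?nm_ge0// !N; auto.
move=> e1.
have : nm (h + h) <= nm (h + ii * k) + nm (h + - ii * k).
  by apply: le_trans (nmD _ _); rewrite addrACA -mulrDl subrr mul0r addr0.
rewrite -e1 -{1 2}(mul1r h) -mulrDl -cst1 -cstD nm_cstM ger0_norm// => l1.
rewrite -(N ii); last by left.
rewrite -hh nm_sa// ler_sqr ?nnegrE ?nm_ge0//; lra.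
Qed.

(** With t = |a + b|, the element t - a = (t - (a + b)) + b is positive and commutes with a, and its
    sum with a is t. This reduces the claim to the commuting case. *)
Lemma pos_le_nmD a b : pos a -> pos b -> nm a <= nm (a + b).
Proof.
move=> pa pb; set t := nm (a + b).
have as_ := pos_star pa; have bs := pos_star pb.
have pt : pos (cst t - a).
  have -> : cst t - a = (cst t - (a + b)) + b by rewrite opprD addrA subrK.
  by apply: posD => //; apply: pos_cstB => //; rewrite starD as_ bs.
have C : GRing.comm a (cst t - a).
  by apply: commrB => //; exact: commr_cst.
apply: le_trans (pos_le_nmD_comm pa pt C) _.
by rewrite addrC subrK (le_trans (nm_cst _ _))// ger0_norm// nm_ge0.
Qed.

Lemma pos_anti a : pos a -> pos (- a) -> a = 0.
Proof. by move=> h1 h2; apply: nm_le0; rewrite -(nm0 A) -(subrr a) pos_le_nmD. Qed.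

Lemma cvg_pos (u : nat -> A) a :
  u @ \oo --> a -> (forall n, pos (u n)) -> pos a.
Proof.
move=> ua pu; split.
  apply: cvg_uniq (cvg_star ua) _.
  by under eq_fun do rewrite (pos_star (pu _)).
(* A single t for the tail of the sequence: eventually |u n| <= |a| + 1, and [pos_nm] accepts any
   such bound. *)
exists (nm a + 1).
have cu : (fun n => cst (nm a + 1) - u n) @ \oo --> cst (nm a + 1) - a.
  by apply: cvgB => //; exact: cvg_cst.
apply: cvg_nm_le cu _.
move/cvg_nm/(_ _ ltr01) : ua; apply: filterS => n h.
apply: pos_nm => //; rewrite -[u n](subKr a).
by rewrite (le_trans (nmB _ _))// lerD2l ltW.
Qed.

Lemma nm_exp2 h n : star h = h -> nm (h ^+ (2 ^ n)) = nm h ^+ (2 ^ n).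
Proof.
move=> hs; elim: n => [|n IH]; first by rewrite !expr1.
by rewrite expnSr !exprM -IH expr2 nm_sa// star_exp hs.
Qed.

(** A linear factor disappears under repeated squaring, as in the spectral radius formula. *)
Lemma pow_le_linear (r C : R) : 0 <= r -> 0 <= C ->
  (forall n, r ^+ (2 ^ n) <= 1 + (2 ^ n)%:R * C) -> r <= 1.
Proof.
move=> r0 C0 H; rewrite leNgt; apply/negP => r1.
pose d := r - 1; have d0 : 0 < d by rewrite subr_gt0.
have B n : 1 + n%:R * d <= r ^+ n.
  elim: n => [|n IH]; first by rewrite mul0r addr0 expr0.
  have n0 : 0 <= n%:R * d * d by rewrite !mulr_ge0 ?ler0n ?(ltW d0).
  have h := ler_wpM2l r0 IH; rewrite exprS; apply: le_trans h.
  have -> : r * (1 + n%:R * d) = (1 + d) * (1 + n%:R * d) by rewrite /d; ring.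
  rewrite -(natr1 n); lra.
(* With m = 2^N, Bernoulli gives r^(2 m) >= (m d)^2, quadratic in m, against the assumed bound 1 + 2
   m C. This N makes m d^2 > 1 + 2 C, a contradiction since m >= 1. *)
have [N HN] : exists N, (1 + 2 * C) / d ^+ 2 < N%:R.
  by exists (Num.bound ((1 + 2 * C) / d ^+ 2)); rewrite archi_boundP// divr_ge0// ?sqr_ge0//; lra.
have N2 : N%:R <= (2 ^ N)%:R :> R by rewrite ler_nat ltnW// ltn_expl.
set m : R := (2 ^ N)%:R in N2.
have m1 : 1 <= m by rewrite /m ler1n expn_gt0.
have := H N.+1; rewrite expnSr exprM natrM -/m => H1.
have H2 := B (2 ^ N)%N; rewrite -/m in H2.
have md : 0 <= m * d by rewrite mulr_ge0 ?(ltW d0)//; lra.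
have H3 : (m * d) ^+ 2 <= 1 + m * 2 * C.
  apply: le_trans H1; rewrite ler_sqr ?nnegrE ?exprn_ge0//; lra.
have H4 : 1 + 2 * C < m * d ^+ 2.
  by rewrite -ltr_pdivrMr ?exprn_gt0// (lt_le_trans HN).
have : m * (1 + 2 * C) < m * (m * d ^+ 2) by rewrite ltr_pM2l//; lra.
rewrite exprMn in H3; nra.
Qed.

(* [(t - x x')^n = t^n - x w x'], where [x' = star x], for some [w] of norm at
   most [n M^(n-1)], where [M] bounds [t] and [t - x' x]. *)
Lemma nm_cstB_swap x t : 0 <= t ->
  nm (cst t - x * star x) <= Num.max t (nm (cst t - star x * x)).
Proof.
move=> t0; set M := Num.max _ _.
set u := cst t - x * star x; set v := cst t - star x * x.
have us : star u = u by rewrite starB starMr starK cst_star.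
have tM : t <= M by rewrite le_max lexx.
have vM : nm v <= M by rewrite le_max lexx orbT.
have := le_trans t0 tM; rewrite le_eqVlt => /predU1P[M0|M0].
  have tz : t = 0 by apply: le_anti; rewrite t0 M0 tM.
  rewrite -M0 in vM *; rewrite /u tz cst0 sub0r nmN -{1}(starK x) nm_starM nm_star.
  by move: vM; rewrite /v tz cst0 sub0r nmN nm_starM.
(* This intertwining moves u past x', which gives the recursion w_(n+1) = t^n + w_n v. *)
have xu : star x * u = v * star x.
  by rewrite /u /v mulrBr mulrBl cstC mulrA.
have W n : exists2 w, u ^+ n = cst (t ^+ n) - x * w * star x &
    nm w * M <= n%:R * M ^+ n.
  elim: n => [|n [w Hw nw]].
    exists 0; last by rewrite nm0 !mul0r.
    by rewrite !expr0 mulr0 mul0r subr0 cst1.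
  exists (cst (t ^+ n) + w * v).
    rewrite exprSr Hw mulrBl {1}/u mulrBr -cstM -exprSr.
    rewrite -(mulrA (x * w)) xu -(addrA (cst _)) -opprD; congr (_ - _).
    by rewrite (mulrDr x (cst _) (w * v)) (mulrDl _ _ (star x)) -cstC !mulrA.
  have h1 : nm (cst (t ^+ n)) <= M ^+ n.
    rewrite (le_trans (nm_cst _ _))// ger0_norm ?exprn_ge0//.
    by rewrite lerXn2r ?nnegrE// (ltW M0).
  have h2 := nmD (cst (t ^+ n)) (w * v).
  have h3 := nmM w v; have w0 := nm_ge0 w; have v0 := nm_ge0 v.
  rewrite -natr1 exprS.
  have h4 : nm w * nm v <= nm w * M by rewrite ler_wpM2l.
  have h5 : nm (cst (t ^+ n) + w * v) <= M ^+ n + n%:R * M ^+ n by lra.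
  have h6 := ler_wpM2r (ltW M0) h5.
  by rewrite (le_trans h6)// le_eqVlt; apply/orP; left; apply/eqP; ring.
rewrite -(@ler_pM2r _ M^-1) ?invr_gt0// divff ?gt_eqF//.
have x0 := nm_ge0 x.
(* Since u is self-adjoint, |u|^(2^n) = |u^(2^n)|. Dividing the expansion of the power by M^(2^n)
   leaves 1 + 2^n C with C = |x|^2 / M. *)
apply: (@pow_le_linear _ (nm x * nm x / M)).
- by rewrite divr_ge0// ?nm_ge0// ltW.
- by rewrite divr_ge0 ?mulr_ge0// ltW.
move=> n; rewrite expr_div_n ler_pdivrMr ?exprn_gt0// -nm_exp2//.
have [w -> nw] := W (2 ^ n)%N.
set m := (2 ^ n)%N in nw *.
have h1 : nm (cst (t ^+ m)) <= M ^+ m.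
  rewrite (le_trans (nm_cst _ _))// ger0_norm ?exprn_ge0//.
  by rewrite lerXn2r ?nnegrE// (ltW M0).
have h2 := nmB (cst (t ^+ m)) (x * w * star x).
have h3 : nm (x * w * star x) <= nm x * nm w * nm x.
  rewrite (le_trans (nmM _ _))// nm_star ler_wpM2r//; exact: nmM.
have h4 : nm w <= m%:R * M ^+ m / M by rewrite ler_pdivlMr.
have h5 : nm x * nm w * nm x <= nm x * (m%:R * M ^+ m / M) * nm x.
  by rewrite ler_wpM2r// ler_wpM2l.
have -> : (1 + m%:R * (nm x * nm x / M)) * M ^+ m = M ^+ m + nm x * (m%:R * M ^+ m / M) * nm x.
  by field; rewrite gt_eqF.
lra.
Qed.

Lemma pos_swap x : pos (star x * x) -> pos (x * star x).
Proof.
move=> [_ [t ht]]; split; first by rewrite starMr starK.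
exists t; have t0 := le_trans (nm_ge0 _) ht.
by rewrite (le_trans (nm_cstB_swap _ t0))// ge_max lexx.
Qed.
End Positive.

(** * Positivity of x' x and the Cauchy-Schwarz inequality for finite sums *)

Section KelleyVaught.
Variables (R : realType) (A : cstarAlgType R).
Implicit Types (a b p q x y z h k c n : A) (t s r : R).
Local Notation cst := (@cst R A).
Local Notation ii := (ii A).

Lemma addrr_cst a : a + a = cst 2 * a.
Proof. by rewrite (_ : 2 = 1 + 1)// cstD cst1 mulrDl mul1r. Qed.

Lemma pos_half a : pos (a + a) -> pos a.
Proof.
move=> /(@pos_cstM _ _ 2^-1); rewrite invr_ge0 => /(_ (ler0n _ 2)).
by rewrite addrr_cst mulrA -cstM mulVf// cst1 mul1r.
Qed.

(** Twice this element is the sum of the squares of the self-adjoint elements c + c' and i (c -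
    c'). *)
Lemma pos_starM_addC c : pos (star c * c + c * star c).
Proof.
apply: pos_half.
have hs : star (c + star c) = c + star c by rewrite starD starK addrC.
have ks : star (ii * (c - star c)) = ii * (c - star c).
  by rewrite starMr ii_star starB starK mulrN -iiC -mulrN opprB.
have := posD (pos_sq hs) (pos_sq ks).
rewrite -mulrA (mulrA _ ii) -iiC -!mulrA iiK.
have sqD a b : (a + b) * (a + b) = (a * a + b * b) + (b * a + a * b).
  by rewrite mulrDl !mulrDr (addrC (b * a)) addrACA (addrC (a * b)).
rewrite !sqD mulrNN !mulrN !mulNr -opprD opprB.
set p := c * c + _; set s := _ + c * star c.
by rewrite addrC addrA subrK.
Qed.

Lemma sqr_eq0_sa a : star a = a -> a * a = 0 -> a = 0.
Proof.
move=> as_ aa; apply: nm0_eq0; apply/eqP.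
by rewrite -sqrf_eq0 -nm_sa// aa nm0.
Qed.

(* With [b = x' x], [q = |b|], [n = q - b] (twice the negative part of [b]) and
   [g] the square root of [q], the element [c = x n g] satisfies
   [4 c' c = - n^4 <= 0]. As [c' c + c c' >= 0], this forces [c' c = 0], so
   [n = 0]. *)
Lemma pos_starM x : pos (star x * x).
Proof.
set b := star x * x.
have bs : star b = b by rewrite starMr starK.
have [q [pq qq qc]] := pos_sqrt (pos_sq bs).
have [g [pg gg gc]] := pos_sqrt pq.
have qs := pos_star pq; have gs := pos_star pg.
have bq : GRing.comm b q by apply: qc; exact: commrM.
have bg : GRing.comm b g by exact: gc.
have qg : GRing.comm q g by exact: gc.
have [n nE] : exists n, n = q - b by exists (q - b).
have ns : star n = n by rewrite nE starB qs bs.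
have bn : GRing.comm b n by rewrite nE; apply: commrB.
have qn : GRing.comm q n by rewrite nE; apply: commrB => //; exact: commr_sym.
have ng : GRing.comm n g by rewrite nE; apply/commr_sym; apply: commrB; exact: commr_sym.
(* q n = - b n because q^2 = b^2 and b, q commute; hence 2 b n = - n^2 and 2 q n = n^2. *)
have n2 : n * n = - (b * n + b * n).
  rewrite {1}nE mulrBl.
  have -> : q * n = - (b * n).
    by rewrite nE !mulrBr qq opprB bq.
  by rewrite opprD.
have nq : n * q + n * q = n * n.
  have -> : n * q = n * n + b * n by rewrite bn -mulrDr nE subrK.
  by rewrite addrACA -[b * n + b * n]opprK -n2 addrK.
pose c := x * n * g.
have cc : star c * c = (b * n) * (n * q).
  have -> : star c * c = g * n * b * (n * g).
    by rewrite /c !starMr gs ns /b !mulrA.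
  have -> : g * n * b = b * n * g.
    by rewrite -mulrA -bn mulrA -bg -mulrA -ng mulrA.
  by rewrite -mulrA ng (mulrA g g) gg qn.
have negc : pos (- (star c * c)).
  apply: pos_half; apply: pos_half.
  have -> : - (star c * c) + - (star c * c) + (- (star c * c) + - (star c * c)) = (n * n) * (n * n).
    rewrite {1}n2 -{1}nq mulNr mulrDl !mulrDr cc.
    by rewrite -!opprD.
  by apply: pos_sq; rewrite starMr ns.
(* Adding - c' c to c' c + c c' makes c c' positive. Then [pos_swap] makes c' c positive as well,
   and [pos_anti] kills it. *)
have pcc : pos (c * star c).
  have := posD (pos_starM_addC c) negc.
  by rewrite addrAC subrr add0r.
have pc : pos (star c * c).
  have := @pos_swap _ _ (star c); rewrite starK; exact.
have c0 := pos_anti pc negc.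
have nn0 : n * n = 0.
  apply: sqr_eq0_sa; first by rewrite starMr ns.
  rewrite {1}n2 -{1}nq mulNr mulrDl !mulrDr -cc c0.
  by rewrite !addr0 oppr0.
have n0 := sqr_eq0_sa ns nn0.
by move/eqP: n0; rewrite nE subr_eq0 => /eqP <-.
Qed.

(** With p = k^2 this is (k x)' (k x). *)
Lemma pos_congr p x : pos p -> pos (star x * p * x).
Proof.
move=> /pos_sqrt[k [pk <- _]].
by have := pos_starM (k * x); rewrite starMr (pos_star pk) !mulrA.
Qed.

Section FiniteSums.
Variables (I : Type) (s : seq I).
Implicit Types u v : I -> A.
Local Notation ip u v := (\sum_(i <- s) star (u i) * v i).

(** Let r >= |(u, u)| and w = r v - u c. Adding c' (r - (u, u)) c >= 0 to (w, w) >= 0 gives r (r (v,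
    v) - c' c) >= 0, and monotonicity of the norm concludes. The sums run over any list so that
    tails of series are covered. *)
Lemma nm_ip_sqr u v : nm (ip u v) ^+ 2 <= nm (ip u u) * nm (ip v v).
Proof.
set c := ip u v.
have star_ip : star c = ip v u.
  by rewrite star_sum; apply: eq_bigr => i _; rewrite starMr starK.
(* r must be positive for the division below; |(u, u)| is approached by larger r, unless |(v, v)| =
   0, where any admissible r serves. *)
suff H (r : R) : 0 < r -> nm (ip u u) <= r -> nm c ^+ 2 <= r * nm (ip v v).
  have [v0|v0] := eqVneq (nm (ip v v)) 0.
    rewrite v0 mulr0; have := H (nm (ip u u) + 1).
    by rewrite v0 mulr0; apply; rewrite ?ltr_wpDl ?nm_ge0// lerDl.
  have vp : 0 < nm (ip v v) by rewrite lt_neqAle eq_sym v0 nm_ge0.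
  apply/ler_addgt0Pr => e e0.
  have := H (nm (ip u u) + e / nm (ip v v)).
  rewrite mulrDl divfK//; apply; last by rewrite lerDl divr_ge0// ltW.
  by rewrite ltr_wpDl ?nm_ge0// divr_gt0.
move=> r0 ur.
have rn : r != 0 by rewrite gt_eqF.
pose w i := cst r * v i - u i * c.
have pu : pos (ip u u) by apply: pos_sum => i _; exact: pos_starM.
have pw : pos (ip w w) by apply: pos_sum => i _; exact: pos_starM.
have Ew : ip w w = cst r * (cst r * ip v v) - cst r * (star c * c) -
    cst r * (star c * c) + star c * ip u u * c.
  transitivity (\sum_(i <- s) (cst r * (cst r * (star (v i) * v i)) -
      cst r * ((star (v i) * u i) * c) - cst r * (star c * (star (u i) * v i)) +
      star c * (star (u i) * u i) * c)).
    apply: eq_bigr => i _.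
    rewrite /w starB !starMr cst_star mulrBl !mulrBr.
have rC z : z * cst r = cst r * z by rewrite cstC.
    rewrite !rC opprB addrA -!mulrA.
    rewrite (mulrA (star (v i)) (cst r)) rC -!mulrA.
    rewrite (mulrA (star (u i)) (cst r)) rC -!mulrA (mulrA (star c) (cst r)) rC -!mulrA.
    by rewrite addrAC -addrA [X in _ + X]addrC !addrA.
  rewrite big_split/= !sumrB -!mulr_sumr -!mulr_suml -star_ip.
  by rewrite -mulr_sumr.
have H : pos (cst r * ip v v - star c * c).
  have h := pos_congr c (pos_cstB (pos_star pu) ur).
  have := pos_cstM _ (posD pw h) => /(_ r^-1); rewrite invr_ge0 (ltW r0) => /(_ isT).
  congr pos; rewrite Ew mulrBr mulrBl -cstC.
  rewrite -addrA (addrC (star c * _ * c)) subrK -(mulrA (cst r)) subrK -mulrBr.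
  by rewrite mulrA -cstM mulVf// cst1 mul1r.
have := pos_le_nmD (pos_starM c) H.
by rewrite addrC subrK nm_starM nm_cstM ger0_norm// ltW.
Qed.
End FiniteSums.
End KelleyVaught.

(** * The standard Hilbert module *)

Section StandardModuleTheory.
Variables (R : realType) (A : cstarAlgType R).
Implicit Types (a b : A) (x y z u v w : A ^nat) (t s r e : R).
Local Notation cst := (@cst R A).
Local Notation S u v m n := (\sum_(m <= i < n) star (u i) * v i).

Lemma cvg_series_nm u : cvgn (series u) <->
  forall e, 0 < e -> exists N, forall m n, (N <= m)%N -> nm (\sum_(m <= i < n) u i) < e.
Proof.
have E m n : (m <= n)%N -> series u n = series u m + \sum_(m <= i < n) u i.
  by move=> mn; rewrite /series/= -big_cat_nat.
split.
  move=> /cvg_ex[/= l /cvg_nm ul] e e0.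
  have e2 : 0 < e / 2 by rewrite divr_gt0.
  have [N _ HN] := ul _ e2.
  exists N => m n Nm; have [mn|nm_] := leqP m n; last first.
    by rewrite big_geq ?nm0// ltnW.
  have -> : \sum_(m <= i < n) u i = (l - series u m) - (l - series u n).
    by rewrite (E _ _ mn) opprB [RHS]addrC addrA subrK addrAC subrr add0r.
  rewrite (le_lt_trans (nmB _ _))//.
  by rewrite [ltRHS]splitr ltrD// HN//= (leq_trans Nm).
move=> H; apply: cvg_cauchy_nm => e e0; have [N HN] := H e e0.
exists N => m n; wlog mn : m n / (n <= m)%N.
  move=> W Nm Nn; have /orP[h|h] := leq_total n m; first exact: W.
  by rewrite nmC; exact: W.
by move=> Nm Nn; rewrite (E _ _ mn) addrAC subrr add0r HN.
Qed.

(** Cauchy-Schwarz and 2 a b <= a^2 + b^2 bound the cross terms by |U| + |V|. This serves before the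
    triangle inequality is available, in particular for sums in [l2]. *)
Lemma nm_ipDD (I : Type) (s : seq I) (u v : I -> A) :
  nm (\sum_(i <- s) star (u i + v i) * (u i + v i)) <=
  2 * nm (\sum_(i <- s) star (u i) * u i) + 2 * nm (\sum_(i <- s) star (v i) * v i).
Proof.
set U := \sum_(i <- s) star (u i) * u i; set V := \sum_(i <- s) star (v i) * v i.
pose W := \sum_(i <- s) star (u i) * v i.
have -> : \sum_(i <- s) star (u i + v i) * (u i + v i) = (U + V) + (W + star W).
  rewrite star_sum /U /V /W -!big_split/=; apply: eq_bigr => i _.
  by rewrite starMr starK starD mulrDl !mulrDr addrACA [in LHS](addrC _ (star (v i) * v i)) addrACA.
have h := nm_ip_sqr s u v; rewrite -/U -/V -/W in h.
have h1 := nmD (U + V) (W + star W); have h2 := nmD U V.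
have h3 := nmD W (star W); rewrite nm_star in h3.
have U0 := nm_ge0 U; have V0 := nm_ge0 V; have W0 := nm_ge0 W.
have : 2 * nm W <= nm U + nm V.
  have h5 := sqr_ge0 (nm U - nm V).
  rewrite -ler_sqr ?nnegrE ?mulr_ge0 ?addr_ge0//; lra.
lra.
Qed.

Lemma l2P x : l2 A x <->
  forall e, 0 < e -> exists N, forall m n, (N <= m)%N -> nm (S x x m n) < e.
Proof. exact: cvg_series_nm. Qed.

Lemma l2D x y : l2 A x -> l2 A y -> l2 A (x + y).
Proof.
move=> /l2P hx /l2P hy; apply/l2P => e e0.
have e4 : 0 < e / 4 by rewrite divr_gt0.
have [N HN] := hx _ e4; have [M HM] := hy _ e4.
exists (maxn N M) => m n; rewrite geq_max => /andP[Nm Mm].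
have h1 := HN m n Nm; have h2 := HM m n Mm.
by rewrite (le_lt_trans (nm_ipDD _ _ _))//; lra.
Qed.

Lemma l2_ip_cvg x y : l2 A x -> l2 A y ->
  (fun n => S x y 0 n) @ \oo --> l2_ip x y.
Proof.
move=> /l2P hx /l2P hy.
suff /cvg_series_nm : forall e, 0 < e -> exists N, forall m n, (N <= m)%N ->
  nm (S x y m n) < e by [].
move=> e e0.
have [N HN] := hx _ e0; have [M HM] := hy _ e0.
exists (maxn N M) => m n; rewrite geq_max => /andP[Nm Mm].
have h1 := HN m n Nm; have h2 := HM m n Mm.
have h := nm_ip_sqr (index_iota m n) x y.
rewrite -ltr_sqr ?nnegrE ?nm_ge0 ?(ltW e0)//.
by rewrite (le_lt_trans h)// expr2 ltr_pM// nm_ge0.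
Qed.

Lemma l2_ext x y : l2 A x -> (forall m n, nm (S y y m n) <= nm (S x x m n)) -> l2 A y.
Proof.
move=> /l2P hx H; apply/l2P => e /hx[N HN]; exists N => m n Nm.
exact: le_lt_trans (H _ _) (HN _ _ Nm).
Qed.

Lemma l2_0 : l2 A 0.
Proof.
apply/l2P => e e0; exists 0%N => m n _.
by rewrite big1 ?nm0// => i _; rewrite mulr0.
Qed.

Lemma l2N x : l2 A x -> l2 A (- x).
Proof.
move=> hx; apply: (l2_ext hx) => m n.
by under eq_bigr do rewrite [(- x) _]/(- _) starN mulrNN.
Qed.

Lemma l2B x y : l2 A x -> l2 A y -> l2 A (x - y).
Proof. by move=> hx hy; apply: l2D => //; exact: l2N. Qed.

Lemma l2_actP x a : l2 A x -> l2 A (l2_act x a).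
Proof.
move=> /l2P hx; apply/l2P => e e0.
pose K := nm a * nm a + 1.
have K0 : 0 < K by rewrite ltr_wpDl// mulr_ge0// nm_ge0.
have eK : 0 < e / K by rewrite divr_gt0.
have [N HN] := hx _ eK.
exists N => m n Nm; have h := HN m n Nm.
have -> : S (l2_act x a) (l2_act x a) m n = star a * S x x m n * a.
  rewrite mulr_sumr mulr_suml; apply: eq_bigr => i _.
  by rewrite /l2_act cmulE starMr !mulrA.
rewrite (le_lt_trans (nmM _ _))//.
have h1 := nmM (star a) (S x x m n); rewrite nm_star in h1.
have a0 := nm_ge0 a; have s0 := nm_ge0 (S x x m n).
move: h; rewrite ltr_pdivlMr// /K; nra.
Qed.

Lemma ipDr x y z : l2 A x -> l2 A y -> l2 A z ->
  l2_ip x (y + z) = l2_ip x y + l2_ip x z.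
Proof.
move=> hx hy hz; apply: cvg_uniq (l2_ip_cvg hx (l2D hy hz)) _.
under eq_fun do under eq_bigr do rewrite [(y + z) _]/(_ + _) mulrDr.
under eq_fun do rewrite big_split/=.
by apply: cvgD; exact: l2_ip_cvg.
Qed.

Lemma ip_star x y : l2 A x -> l2 A y -> star (l2_ip x y) = l2_ip y x.
Proof.
move=> hx hy; apply: cvg_uniq (cvg_star (l2_ip_cvg hx hy)) _.
have -> : (fun n => star (S x y 0 n)) = (fun n => S y x 0 n).
  apply/funext => n; rewrite star_sum; apply: eq_bigr => i _.
  by rewrite starMr starK.
exact: l2_ip_cvg.
Qed.

Lemma ip_actr x y a : l2 A x -> l2 A y -> l2_ip x (l2_act y a) = l2_ip x y * a.
Proof.
move=> hx hy; apply: cvg_uniq (l2_ip_cvg hx (l2_actP (a := a) hy)) _.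
have -> : (fun n => S x (l2_act y a) 0 n) = (fun n => S x y 0 n * a).
  apply/funext => n; rewrite mulr_suml; apply: eq_bigr => i _.
  by rewrite /l2_act cmulE mulrA.
by apply: cvg_mul; [exact: l2_ip_cvg|exact: cvg_cst].
Qed.

Lemma ipDl x y z : l2 A x -> l2 A y -> l2 A z ->
  l2_ip (x + y) z = l2_ip x z + l2_ip y z.
Proof.
move=> hx hy hz; have hxy := l2D hx hy.
by rewrite -(ip_star hz hxy) ipDr// starD !ip_star.
Qed.

Lemma ip_actl x y a : l2 A x -> l2 A y -> l2_ip (l2_act x a) y = star a * l2_ip x y.
Proof.
move=> hx hy; have hxa := l2_actP (a := a) hx.
by rewrite -(ip_star hy hxa) ip_actr// starMr ip_star.
Qed.

Lemma l2_actN x : l2_act x (- 1) = - x.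
Proof. by apply/funext => i; rewrite /l2_act cmulE mulrN mulr1. Qed.

Lemma l2_actD x a b : l2_act x (a + b) = l2_act x a + l2_act x b.
Proof. by apply/funext => i; rewrite /l2_act cmulE mulrDr. Qed.

Lemma l2_actDl x y a : l2_act (x + y) a = l2_act x a + l2_act y a.
Proof. by apply/funext => i; rewrite /l2_act cmulE [(x + y) _]/(_ + _) mulrDl. Qed.

Lemma l2_actA x a b : l2_act (l2_act x a) b = l2_act x (a * b).
Proof. by apply/funext => i; rewrite /l2_act !cmulE mulrA. Qed.

Lemma l2_act1 x : l2_act x 1 = x.
Proof. by apply/funext => i; rewrite /l2_act cmulE mulr1. Qed.

Lemma ipNr x y : l2 A x -> l2 A y -> l2_ip x (- y) = - l2_ip x y.
Proof. by move=> hx hy; rewrite -l2_actN ip_actr// mulrN mulr1. Qed.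

Lemma ipNl x y : l2 A x -> l2 A y -> l2_ip (- x) y = - l2_ip x y.
Proof. by move=> hx hy; rewrite -l2_actN ip_actl// starN star1 mulNr mul1r. Qed.

Lemma ipBr x y z : l2 A x -> l2 A y -> l2 A z ->
  l2_ip x (y - z) = l2_ip x y - l2_ip x z.
Proof. by move=> hx hy hz; rewrite ipDr ?ipNr//; exact: l2N. Qed.

Lemma ipBl x y z : l2 A x -> l2 A y -> l2 A z ->
  l2_ip (x - y) z = l2_ip x z - l2_ip y z.
Proof. by move=> hx hy hz; rewrite ipDl ?ipNl//; exact: l2N. Qed.

Lemma ip0r x : l2 A x -> l2_ip x 0 = 0.
Proof. by move=> hx; have := ipBr hx hx hx; rewrite !subrr. Qed.

Lemma ip0l x : l2 A x -> l2_ip 0 x = 0.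
Proof. by move=> hx; rewrite -(ip_star hx l2_0) ip0r// star0. Qed.

Lemma pos_ip x : l2 A x -> pos (l2_ip x x).
Proof.
move=> hx; apply: (cvg_pos (l2_ip_cvg hx hx)) => n.
by apply: pos_sum => i _; exact: pos_starM.
Qed.

Definition l2n x : R := Num.sqrt (nm (l2_ip x x)).

Lemma l2n_ge0 x : 0 <= l2n x. Proof. exact: sqrtr_ge0. Qed.

Lemma l2n_sqr x : l2n x ^+ 2 = nm (l2_ip x x).
Proof. by rewrite sqr_sqrtr// nm_ge0. Qed.

Lemma l2_normE x : l2_norm x = (l2n x)%:C.
Proof.
rewrite /l2_norm normE -l2n_sqr rmorphXn/= sqrCK// lecR; exact: l2n_ge0.
Qed.

Lemma ip_cauchy_schwarz x y : l2 A x -> l2 A y -> nm (l2_ip x y) <= l2n x * l2n y.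
Proof.
move=> hx hy.
rewrite -ler_sqr ?nnegrE ?mulr_ge0 ?l2n_ge0 ?nm_ge0// exprMn !l2n_sqr.
have cxy := l2_ip_cvg hx hy; have cxx := l2_ip_cvg hx hx; have cyy := l2_ip_cvg hy hy.
have C u a : u @ \oo --> a -> (fun n => nm (u n)) @ \oo --> nm a.
  move=> /cvg_nm ua; apply/cvgrPdist_lt => e /ua; apply: filterS => n.
  apply: le_lt_trans; rewrite ler_norml.
  have h1 := nmD (a - u n) (u n); have h2 := nmB a (a - u n).
  by rewrite subrK in h1; rewrite subKr in h2; apply/andP; split; lra.
have c1 : (fun n => nm (S x y 0 n) * nm (S x y 0 n)) @ \oo -->
    nm (l2_ip x y) * nm (l2_ip x y) by apply: cvgM; exact: C.
have c2 : (fun n => nm (S x x 0 n) * nm (S y y 0 n)) @ \oo -->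
    nm (l2_ip x x) * nm (l2_ip y y) by apply: cvgM; exact: C.
rewrite expr2; apply: ler_cvg_to c1 c2 _.
by apply: nearW => n; rewrite -expr2; exact: nm_ip_sqr.
Qed.

Lemma l2nD x y : l2 A x -> l2 A y -> l2n (x + y) <= l2n x + l2n y.
Proof.
move=> hx hy; rewrite -ler_sqr ?nnegrE ?addr_ge0 ?l2n_ge0// l2n_sqr.
have hxy := l2D hx hy; rewrite ipDl// !ipDr//.
have h1 := nmD (l2_ip x x + l2_ip x y) (l2_ip y x + l2_ip y y).
have h2 := nmD (l2_ip x x) (l2_ip x y); have h3 := nmD (l2_ip y x) (l2_ip y y).
have h4 := ip_cauchy_schwarz hx hy; have h5 := ip_cauchy_schwarz hy hx.
rewrite sqrrD !l2n_sqr; lra.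
Qed.

Lemma l2nN x : l2 A x -> l2n (- x) = l2n x.
Proof. by move=> hx; rewrite /l2n ipNl ?ipNr ?opprK//; exact: l2N. Qed.

Lemma l2nB x y : l2 A x -> l2 A y -> l2n (x - y) <= l2n x + l2n y.
Proof. by move=> hx hy; rewrite -(l2nN hy) l2nD//; exact: l2N. Qed.

Lemma l2nC x y : l2 A x -> l2 A y -> l2n (x - y) = l2n (y - x).
Proof. by move=> hx hy; rewrite -opprB l2nN//; exact: l2B. Qed.

Lemma l2n_cst x t : l2 A x -> l2n (l2_act x (cst t)) = `|t| * l2n x.
Proof.
move=> hx; apply/eqP; rewrite -(@eqrXn2 _ 2) ?mulr_ge0 ?l2n_ge0//.
rewrite exprMn !l2n_sqr ip_actl ?ip_actr//; last exact: l2_actP.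
by rewrite cst_star -cstC !nm_cstM expr2 mulrA.
Qed.

Lemma l2n0 : l2n 0 = 0.
Proof. by rewrite /l2n (ip0r l2_0) nm0 sqrtr0. Qed.

(** All terms are positive, so completing a block to a longer partial sum does not lower its
    norm. *)
Lemma nm_sum_le_l2n x m n : l2 A x -> nm (S x x m n) <= l2n x ^+ 2.
Proof.
move=> hx; have P (I : Type) (s : seq I) (u : I -> A) : pos (\sum_(i <- s) star (u i) * u i).
  by apply: pos_sum => i _; exact: pos_starM.
have [mn|nm_] := leqP n m; first by rewrite big_geq// nm0 exprn_ge0// l2n_ge0.
have H k : (n <= k)%N -> nm (S x x m n) <= nm (S x x 0 k).
  move=> nk; rewrite (@big_cat_nat _ _ _ m 0 k)//=; last by rewrite (leq_trans (ltnW nm_)).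
  rewrite (@big_cat_nat _ _ _ n m k)//=; last exact: ltnW.
  rewrite addrCA; apply: pos_le_nmD => //; exact: posD.
rewrite l2n_sqr; apply/ler_addgt0Pr => e e0.
have /cvg_nm/(_ _ e0)[N _ HN] := l2_ip_cvg hx hx.
have := HN (maxn N n) (leq_maxl _ _); have := H _ (leq_maxr N n).
set s := S x x 0 _ => /= h1 h2.
have := nmB (l2_ip x x) (l2_ip x x - s); rewrite subKr => h3.
lra.
Qed.

Lemma nm_le_l2n x i : l2 A x -> nm (x i) <= l2n x.
Proof.
move=> hx; have := nm_sum_le_l2n i i.+1 hx.
by rewrite big_nat1 nm_starM ler_sqr ?nnegrE ?nm_ge0 ?l2n_ge0.
Qed.

Lemma l2n_eq0 x : l2 A x -> l2n x = 0 -> x = 0.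
Proof.
move=> hx x0; apply/funext => i; apply: nm_le0.
by rewrite (le_trans (nm_le_l2n i hx))// x0.
Qed.

Lemma ip_eq0 x : l2 A x -> l2_ip x x = 0 -> x = 0.
Proof. by move=> hx x0; apply: l2n_eq0 => //; rewrite /l2n x0 nm0 sqrtr0. Qed.

Lemma l2_complete (X : nat -> A ^nat) : (forall n, l2 A (X n)) ->
  (forall e, 0 < e -> exists N, forall m n, (N <= m)%N -> (N <= n)%N ->
    l2n (X m - X n) < e) ->
  exists2 x, l2 A x &
    forall e, 0 < e -> exists N, forall n, (N <= n)%N -> l2n (x - X n) <= e.
Proof.
move=> hX HC.
have hX2 m n : l2 A (X m - X n) by exact: l2B.
have cX i : cvgn (fun n => X n i).
  apply: cvg_cauchy_nm => e /HC[N HN]; exists N => m n Nm Nn.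
  exact: le_lt_trans (nm_le_l2n i (hX2 m n)) (HN _ _ Nm Nn).
pose x : A ^nat := fun i => limn (fun n => X n i).
have xX i : (fun n => X n i) @ \oo --> x i by exact: cX.
(* The Cauchy bound holds for every block of coordinates uniformly; letting m tend to infinity in a
   fixed finite block replaces [X m] by [x]. *)
have key e : 0 < e -> exists N, forall n j k, (N <= n)%N ->
    nm (S (x - X n) (x - X n) j k) <= e ^+ 2.
  move=> e0; have [N HN] := HC e e0; exists N => n j k Nn.
  apply: (@cvg_nm_le _ _ (fun m => S (X m - X n) (X m - X n) j k)); last first.
    exists N => // m Nm; apply: le_trans (nm_sum_le_l2n j k (hX2 m n)) _.
    by rewrite ler_sqr ?nnegrE ?l2n_ge0 ?(ltW e0)// ltW// HN.
  apply: cvg_big => [|i _]; first exact: add_continuous.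
  have c : (fun m => (X m - X n) i) @ \oo --> (x - X n) i.
    by apply: cvgB => //; exact: cvg_cst.
  by apply: cvg_mul => //; exact: cvg_star.
have hx : l2 A x.
  apply/l2P => e e0.
  have q0 : 0 < Num.sqrt (e / 8) by rewrite sqrtr_gt0 divr_gt0.
  have [N HN] := key _ q0.
  have e4 : 0 < e / 4 by rewrite divr_gt0.
  have [M HM] := (l2P (X N)).1 (hX N) _ e4.
  exists M => j k Mj; have := HN N j k (leqnn N); have := HM j k Mj.
  rewrite sqr_sqrtr; last by rewrite divr_ge0// ltW.
  have := nm_ipDD (index_iota j k) (x - X N) (X N).
  rewrite (_ : \sum_(_ <- _) _ * _ = S x x j k); last first.
    by apply: eq_bigr => i _; rewrite [(x - X N) i]/(x i - X N i) subrK.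
  lra.
exists x => // e e0; have [N HN] := key e e0; exists N => n Nn.
rewrite -ler_sqr ?nnegrE ?l2n_ge0 ?(ltW e0)// l2n_sqr.
have hd : l2 A (x - X n) by exact: l2B.
apply: cvg_nm_le (l2_ip_cvg hd hd) _.
by exists 0%N => // k _; exact: HN.
Qed.
End StandardModuleTheory.

(** * Operators *)

Section Operators.
Variables (R : realType) (A : cstarAlgType R).
Implicit Types (a b : A) (x y z u v w : A ^nat) (t s r e : R) (M : set (A ^nat)).
Implicit Types F G T : A ^nat -> A ^nat.
Local Notation cst := (@cst R A).

Lemma l2_linear0 F : l2_linear F -> F 0 = 0.
Proof.
case=> _ FD _; have := FD 0 0 (@l2_0 R A) (@l2_0 R A); rewrite addr0 => h.
by apply: (addrI (F 0)); rewrite -h addr0.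
Qed.

Lemma l2_linearN F x : l2_linear F -> l2 A x -> F (- x) = - F x.
Proof. by case=> _ _ Fa hx; rewrite -l2_actN Fa// l2_actN. Qed.

Lemma l2_linearB F x y : l2_linear F -> l2 A x -> l2 A y -> F (x - y) = F x - F y.
Proof.
move=> hF hx hy; have [_ FD _] := hF.
by have hny := l2N hy; rewrite FD// l2_linearN.
Qed.

Lemma l2_linear_comp F G : l2_linear F -> l2_linear G -> l2_linear (F \o G).
Proof.
move=> [Fl FD Fa] [Gl GD Ga]; split => [x hx|x y hx hy|x a hx] /=.
- exact/Fl/Gl.
- by rewrite GD// FD//; exact: Gl.
- by rewrite Ga// Fa//; exact: Gl.
Qed.

(** The adjoint relation determines [G y], because the inner product separates the points of
    [l2]. *)
Lemma l2_adjoint_linear F G : (forall x, l2 A x -> l2 A (F x)) ->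
  l2_adjoint F G -> l2_linear G.
Proof.
move=> Fl [Gl FG].
have E u v : l2 A u -> l2 A v -> (forall x, l2 A x -> l2_ip x u = l2_ip x v) -> u = v.
  move=> hu hv H; apply/eqP; rewrite -subr_eq0; apply/eqP.
  have huv := l2B hu hv; apply: ip_eq0 => //.
  by rewrite ipBr// H// subrr.
split => [//|x y hx hy|x a hx].
  have hxy := l2D hx hy; have [[gx gy] gxy] := (Gl _ hx, Gl _ hy, Gl _ hxy).
  apply: (E _ _ gxy (l2D gx gy)).
  move=> z hz; have fz := Fl _ hz.
  by rewrite -FG// ipDr// !FG// ipDr.
have hxa := l2_actP (a := a) hx; have gx := Gl _ hx; have gxa := Gl _ hxa.
apply: (E _ _ gxa (l2_actP gx)).
move=> z hz; have fz := Fl _ hz.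
by rewrite -FG// ip_actr// FG// ip_actr.
Qed.

Lemma l2_adjoint_sym F G : (forall x, l2 A x -> l2 A (F x)) ->
  l2_adjoint F G -> l2_adjoint G F.
Proof.
move=> Fl [Gl FG]; split => // x y hx hy.
have [gx fy] := (Gl _ hx, Fl _ hy).
by rewrite -(ip_star hy gx) -FG// ip_star.
Qed.

Lemma l2_adjoint_comp F F' G G' : l2_adjoint F G -> l2_adjoint F' G' ->
  (forall x, l2 A x -> l2 A (F' x)) -> l2_adjoint (F \o F') (G' \o G).
Proof.
move=> [Gl FG] [Gl' FG'] Fl'; split => [y hy|x y hx hy] /=; first exact/Gl'/Gl.
by rewrite FG ?FG'//; [exact: Gl|exact: Fl'].
Qed.

Lemma l2_boundedP F : l2_bounded F <->
  exists2 C : R, 0 <= C & forall x, l2 A x -> l2n (F x) <= C * l2n x.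
Proof.
split=> [[C C0 H]|[C C0 H]]; last first.
  exists C%:C; first by rewrite lecR.
  by move=> x hx; rewrite !l2_normE -rmorphM/= lecR H.
have CE : C = (complex.Re C)%:C by rewrite RRe_real// ger0_real.
exists (complex.Re C); first by rewrite -lecR -CE.
by move=> x /H; rewrite !l2_normE CE -rmorphM/= lecR.
Qed.

Lemma l2_bounded_comp F G : (forall x, l2 A x -> l2 A (G x)) ->
  l2_bounded F -> l2_bounded G -> l2_bounded (F \o G).
Proof.
move=> Gl /l2_boundedP[C C0 HF] /l2_boundedP[D D0 HG].
apply/l2_boundedP; exists (C * D); first exact: mulr_ge0.
move=> x hx; rewrite (le_trans (HF _ (Gl _ hx)))// -mulrA.
by rewrite ler_wpM2l// HG.
Qed.

(** |G y|^2 = |(F G y, y)| <= C |G y| |y|, and |G y| cancels. *)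
Lemma l2_adjoint_bounded F G : (forall x, l2 A x -> l2 A (F x)) ->
  l2_adjoint F G -> l2_bounded F -> l2_bounded G.
Proof.
move=> Fl [Gl FG] /l2_boundedP[C C0 HF]; apply/l2_boundedP; exists C => // y hy.
have gy := Gl _ hy; have fgy := Fl _ gy.
have [->|n0] := eqVneq (l2n (G y)) 0; first by rewrite mulr_ge0// l2n_ge0.
have np : 0 < l2n (G y) by rewrite lt_neqAle eq_sym n0 l2n_ge0.
rewrite -(ler_pM2l np) -expr2 l2n_sqr -FG//.
rewrite (le_trans (ip_cauchy_schwarz fgy hy))//.
have h := ler_wpM2r (l2n_ge0 y) (HF _ gy); rewrite (le_trans h)//.
by rewrite le_eqVlt; apply/orP; left; apply/eqP; ring.
Qed.

Lemma l2_im_submodule F : l2_linear F -> l2_submodule (l2_im F).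
Proof.
move=> hF; have [Fl FD Fa] := hF; split.
- by move=> _ [x hx <-]; exact: Fl.
- by exists 0; [exact: l2_0|exact: l2_linear0].
- move=> _ _ [x hx <-] [y hy <-]; exists (x + y); first exact: l2D.
  exact: FD.
- move=> _ a [x hx <-]; exists (l2_act x a); first exact: l2_actP.
  exact: Fa.
Qed.

Lemma submoduleB M x y : l2_submodule M -> M x -> M y -> M (x - y).
Proof. by move=> [_ _ MD Ma] Mx My; rewrite -l2_actN; apply: MD => //; exact: Ma. Qed.

Lemma closed_real M x : l2_closed M -> l2 A x ->
  (forall e, 0 < e -> exists2 y, M y & l2n (x - y) < e) -> M x.
Proof.
move=> Mc hx H; apply: Mc => // e e0.
have eE : e = (complex.Re e)%:C by rewrite RRe_real// gtr0_real.
have re0 : 0 < complex.Re e by rewrite -ltcR -eE.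
have [y My h] := H _ re0.
by exists y => //; rewrite l2_normE eE ltcR.
Qed.

(** Used for the successive corrections in [approx_surjective] and for the series in
    [adjoint_bounded_below]; both need the explicit error estimate. *)
Lemma geometric_cvg M (W : nat -> A ^nat) (B q : R) :
  l2_submodule M -> l2_closed M -> 0 <= B -> 0 <= q -> q < 1 ->
  (forall n, M (W n)) -> (forall n, l2n (W n.+1 - W n) <= B * q ^+ n) ->
  exists2 w, M w & forall n, l2n (w - W n) <= B * q ^+ n / (1 - q).
Proof.
move=> Ms Mc B0 q0 q1 MW HW; have [Ml _ _ _] := Ms.
have p0 : 0 < 1 - q by rewrite subr_gt0.
have hW n : l2 A (W n) by exact: Ml.
have D n m : (n <= m)%N -> l2n (W m - W n) <= B * (q ^+ n - q ^+ m) / (1 - q).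
  elim: m => [|m IH]; first by rewrite leqn0 => /eqP->; rewrite !subrr l2n0 mulr0 mul0r.
  rewrite leq_eqVlt => /orP[/eqP->|/IH h]; first by rewrite !subrr l2n0 mulr0 mul0r.
  rewrite -(subrK (W m) (W m.+1)) -addrA (le_trans (l2nD (l2B _ _) (l2B _ _)))//.
  rewrite (le_trans (lerD (HW m) h))// le_eqVlt; apply/orP; left; apply/eqP.
  by rewrite exprS; field; rewrite gt_eqF.
have D' n m : (n <= m)%N -> l2n (W m - W n) <= B * q ^+ n / (1 - q).
  move=> nm_; rewrite (le_trans (D _ _ nm_))// ler_pM2r ?invr_gt0//.
  by rewrite ler_wpM2l// gerBl exprn_ge0.
have S e : 0 < e -> exists n, B * q ^+ (2 ^ n) / (1 - q) < e.
  move=> e0; pose K := (B + 1) / (1 - q).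
  have K0 : 0 < K by rewrite divr_gt0// ltr_wpDl.
  have [n hn] := pow_small q0 q1 (divr_gt0 e0 K0).
  exists n; rewrite ltr_pdivlMr// in hn; apply: le_lt_trans hn.
  by rewrite /K mulrA ler_pM2r ?invr_gt0// mulrC ler_wpM2l ?exprn_ge0// lerDl.
have CW e : 0 < e -> exists N, forall m n, (N <= m)%N -> (N <= n)%N ->
    l2n (W m - W n) < e.
  move=> e0; have [N HN] := S e e0; exists (2 ^ N)%N => m n.
  wlog mn : m n / (n <= m)%N.
    move=> H Nm Nn; have /orP[h|h] := leq_total n m; first exact: H.
    by rewrite l2nC//; exact: H.
  move=> Nm Nn; apply: le_lt_trans (D' _ _ mn) (le_lt_trans _ HN).
  rewrite ler_pM2r ?invr_gt0// ler_wpM2l// ler_wiXn2l// ltW//.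
have [w hw cw] := l2_complete hW CW.
have Mw : M w.
  apply: closed_real => // e e0; have e2 : 0 < e / 2 by exact: divr_gt0.
  have [N HN] := cw _ e2.
  exists (W N) => //; apply: le_lt_trans (HN N (leqnn _)) _.
  by rewrite ltr_pdivrMr// ltr_pMr// ltr1n.
exists w => // n; apply/ler_addgt0Pr => e e0; have [N HN] := cw e e0.
have h1 := HN _ (leq_maxl N n); have h2 := D' _ _ (leq_maxr N n).
set m := maxn N n in h1 h2.
rewrite -(subrK (W m) w) -addrA (le_trans (l2nD (l2B hw (hW m)) (l2B (hW m) (hW n))))//.
by rewrite addrC lerD.
Qed.

(** Each residual v - L w is itself solved up to half its norm. The residuals decay like 2^-n, and K
    makes the corrections summable. *)
Lemma approx_surjective M L (C K : R) :
  l2_submodule M -> l2_closed M -> l2_linear L -> (forall x, M x -> M (L x)) ->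
  0 <= C -> (forall x, l2 A x -> l2n (L x) <= C * l2n x) -> 0 <= K ->
  (forall v, M v -> exists w, [/\ M w, l2n w <= K * l2n v &
    l2n (v - L w) <= 2^-1 * l2n v]) ->
  forall v, M v -> exists2 w, M w & L w = v.
Proof.
move=> Ms Mc Ll ML C0 LC K0 H v Mv; have [Ml M0 MD _] := Ms.
have /choice[f Hf] : forall u, exists w, M u -> [/\ M w, l2n w <= K * l2n u &
    l2n (u - L w) <= 2^-1 * l2n u].
  by move=> u; have [Mu|nMu] := pselect (M u);
    [have [w] := H u Mu; exists w|exists 0].
pose W n := iter n (fun w => w + f (v - L w)) 0.
have WE n : W n.+1 = W n + f (v - L (W n)) by [].
have MW n : M (W n).
  elim: n => [//|n IH]; rewrite WE; apply: MD => //.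
  by have [] := Hf (v - L (W n)) (submoduleB Ms Mv (ML _ IH)).
have Mr n : M (v - L (W n)) by apply: submoduleB => //; exact: ML.
have hL x : M x -> l2 A (L x) by move=> Mx; apply: Ml; exact: ML.
have hv := Ml _ Mv.
have R_ n : l2n (v - L (W n)) <= l2n v * 2^-1 ^+ n.
  elim: n => [|n IH].
    by rewrite /W/= l2_linear0// subr0 expr0 mulr1.
  have [Mf _ h] := Hf _ (Mr n).
  have [_ LD _] := Ll.
  rewrite WE LD; [|exact: Ml|exact: Ml].
  rewrite opprD addrA (le_trans h)// exprS mulrCA ler_wpM2l//.
have WC n : l2n (W n.+1 - W n) <= (K * l2n v) * 2^-1 ^+ n.
  rewrite WE addrAC subrr add0r -mulrA.
  have [_ h _] := Hf _ (Mr n); apply: (le_trans h).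
  by rewrite ler_wpM2l.
have h1 : 0 <= (2^-1 : R) by lra.
have h2 : (2^-1 : R) < 1 by lra.
have [w Mw Hw] := geometric_cvg Ms Mc (mulr_ge0 K0 (l2n_ge0 v)) h1 h2 MW WC.
exists w => //; apply/eqP; rewrite -subr_eq0; apply/eqP.
have hw := Ml _ Mw; have hLw := hL _ Mw.
apply: l2n_eq0; first exact: l2B.
apply: le_anti; rewrite l2n_ge0 andbT; apply/ler_addgt0Pr => e e0.
(* Q collects the constants: the two error terms together are at most Q 2^-m after m = 2^n
   corrections. *)
pose Q := C * (K * l2n v / (1 - 2^-1)) + l2n v + 1.
have Q0 : 0 < Q.
  rewrite ltr_wpDl// addr_ge0// ?l2n_ge0// mulr_ge0// divr_ge0 ?mulr_ge0 ?l2n_ge0//; lra.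
have [n hn] := pow_small h1 h2 (divr_gt0 e0 Q0).
rewrite ltr_pdivlMr// in hn.
set p := 2^-1 ^+ (2 ^ n) in hn.
have p0 : 0 <= p by rewrite exprn_ge0.
have hWn := Ml _ (MW (2 ^ n)%N); have hLn := hL _ (MW (2 ^ n)%N).
have -> : L w - v = L (w - W (2 ^ n)%N) - (v - L (W (2 ^ n)%N)).
  by rewrite l2_linearB// opprB addrA subrK.
have hd := l2B hw hWn.
have [Lm _ _] := Ll.
rewrite add0r (le_trans (l2nB (Lm _ hd) (l2B hv hLn)))//.
have g1 := R_ (2 ^ n)%N; have g2 := LC _ hd; have g3 := Hw (2 ^ n)%N.
rewrite -/p in g1 g3.
have g4 := ler_wpM2l C0 g3.
have E : p * Q = C * (K * l2n v * p / (1 - 2^-1)) + l2n v * p + p by rewrite /Q; ring.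
lra.
Qed.
End Operators.

(** * Complements of closed ranges and of kernels *)

Section ClosedRange.
Variables (R : realType) (A : cstarAlgType R).
Implicit Types (a b : A) (x y z u v w : A ^nat) (t s r e : R) (M : set (A ^nat)).
Implicit Types F G T D : A ^nat -> A ^nat.
Local Notation cst := (@cst R A).

(* Otherwise some [z n] in the image have norm [(n + 1) 4^n] while
   [l2n (G (z n)) <= 1], so [nm (l2_ip (z n) (T x)) <= l2n x] for all [n].
   Following Sokal's proof of the uniform boundedness principle, a sum of terms
   [+- 4^-n z n / l2n (z n)] with well-chosen signs is an element [T x] of the
   image violating this bound. *)
Lemma adjoint_bounded_below T G : l2_linear T -> l2_adjoint T G ->
  l2_closed (l2_im T) ->
  exists2 d : R, 0 < d & forall y, l2_im T y -> d * l2n y <= l2n (G y).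
Proof.
move=> Tl TG Tc; have Ms := l2_im_submodule Tl; have [Ml M0 MD Ma] := Ms.
set M := l2_im T in Ms Ml M0 MD Ma Tc *.
have [Gl _] := TG.
apply: contrapT => nd.
have unbounded K : 0 < K -> exists z, [/\ M z, l2n z = K & l2n (G z) <= 1].
  move=> K0; apply: contrapT => nz; apply: nd; exists K^-1; first by rewrite invr_gt0.
  move=> y My; rewrite leNgt; apply/negP => lt; apply: nz.
  have hy := Ml _ My; have hGy := Gl _ hy.
  have y0 : 0 < l2n y.
    rewrite lt_neqAle l2n_ge0 andbT eq_sym; apply/eqP => y0.
    by move: lt; rewrite y0 mulr0 ltNge l2n_ge0.
  have k0 : 0 <= K / l2n y by rewrite divr_ge0 ?l2n_ge0// ltW.
  exists (l2_act y (cst (K / l2n y))); split; first exact: Ma.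
  - by rewrite l2n_cst// ger0_norm// divfK// gt_eqF.
  - have [Tm _ _] := Tl; have [_ _ Ga] := l2_adjoint_linear Tm TG.
    rewrite Ga// l2n_cst// ger0_norm// mulrAC ler_pdivrMr// mul1r.
    by rewrite ltW// -ltr_pdivlMl.
pose p n : R := 4^-1 ^+ n.
have p0 n : 0 < p n by rewrite exprn_gt0// invr_gt0.
have pS n : p n.+1 = 4^-1 * p n by rewrite /p exprS.
pose Kn n : R := n.+1%:R / p n.
have Kn0 n : 0 < Kn n by rewrite divr_gt0// ltr0n.
have /choice[z Hz] : forall n, exists z, [/\ M z, l2n z = Kn n & l2n (G z) <= 1].
  by move=> n; exact: unbounded.
have hz n : l2 A (z n) by apply: Ml; have [] := Hz n.
(* Adding + s z or - s z, with s = p / K, moves w by p. The two inner products with z differ by 2 s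
   (z, z), of norm 2 p K = 2 (n + 1), so one of them has norm at least n + 1. *)
have step n w : exists w', M w -> [/\ M w', l2n (w' - w) <= p n &
    n.+1%:R <= nm (l2_ip (z n) w')].
  have [Mw|] := pselect (M w); last by exists 0.
  have [Mz zK _] := Hz n.
  pose s := p n / Kn n; have s0 : 0 < s by rewrite divr_gt0.
  have hw := Ml _ Mw.
  have hs r : l2 A (l2_act (z n) (cst r)) by exact: l2_actP.
  have E r : l2_ip (z n) (w + l2_act (z n) (cst r)) =
      l2_ip (z n) w + cst r * l2_ip (z n) (z n).
    by rewrite ipDr// ip_actr// cstC.
  have B r : `|r| = s -> M (w + l2_act (z n) (cst r)) /\
      l2n (w + l2_act (z n) (cst r) - w) <= p n.
    move=> rs; split; first by apply: MD => //; exact: Ma.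
    rewrite addrAC subrr add0r l2n_cst// rs zK /s divfK// gt_eqF//.
  have a1 : `|s| = s by rewrite ger0_norm// ltW.
  have a2 : `|- s| = s by rewrite normrN.
  have h : 2 * n.+1%:R <= nm (l2_ip (z n) (w + l2_act (z n) (cst s))) +
      nm (l2_ip (z n) (w + l2_act (z n) (cst (- s)))).
    rewrite !E cstN mulNr.
    set a := l2_ip (z n) w; set b := cst s * _.
    have hb : nm b = n.+1%:R.
      rewrite nm_cstM a1 -l2n_sqr zK /s expr2 mulrA.
      by rewrite divfK ?(gt_eqF (Kn0 n))// /Kn mulrC divfK// gt_eqF.
    have h1 := nmB (a + b) (a - b).
    have e1 : (a + b) - (a - b) = cst 2 * b.
      by rewrite opprB addrAC addrCA subrr addr0 addrr_cst.
    by move: h1; rewrite e1 nm_cstM hb ger0_norm.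
  have [le1|lt1] := leP n.+1%:R (nm (l2_ip (z n) (w + l2_act (z n) (cst s)))).
    by exists (w + l2_act (z n) (cst s)) => _; have [] := B _ a1; split.
  exists (w + l2_act (z n) (cst (- s))) => _; have [b1 b2] := B _ a2; split => //.
  lra.
have /choice[f Hf] : forall nw : nat * (A ^nat), exists w',
    M nw.2 -> [/\ M w', l2n (w' - nw.2) <= p nw.1 &
    nw.1.+1%:R <= nm (l2_ip (z nw.1) w')].
  by move=> [n w]; exact: step.
pose W := fix W n := if n is n.+1 then f (n, W n) else 0.
have MW n : M (W n).
  by elim: n => [//|n IH]; have [] := Hf (n, W n) IH.
have WC n : l2n (W n.+1 - W n) <= 1 * 4^-1 ^+ n.
  by rewrite mul1r; have [] := Hf (n, W n) (MW n).
have q0 : 0 <= (4^-1 : R) by lra.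
have q1 : (4^-1 : R) < 1 by lra.
have [w Mw Hw] := geometric_cvg Ms Tc ler01 q0 q1 MW WC.
have [x hx xw] := Mw.
have hw := Ml _ Mw.
have Bx n : nm (l2_ip (z n) w) <= l2n x.
  have [Mz zK Gz] := Hz n; have hGz := Gl _ (hz n).
  rewrite -xw -(ip_star _ (hz n)); last by rewrite xw.
  rewrite nm_star TG.2// (le_trans (ip_cauchy_schwarz hx hGz))//.
  by rewrite ler_piMr// l2n_ge0.
(* The later corrections total at most 4^-(n+1) / (1 - 1/4) = p n / 3. Against |z n| = (n + 1) / p n
   they cost at most (n + 1) / 3, so the ratio 1/4 leaves two thirds of n + 1. *)
have Lx n : 2 / 3 * n.+1%:R <= l2n x.
  apply: le_trans (Bx n).
  have [_ _ h1] := Hf (n, W n) (MW n).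
  rewrite -[f _]/(W n.+1) /= in h1.
  have hW : l2 A (W n.+1) by apply: Ml.
  have hd := l2B hw hW.
  have h2 := ip_cauchy_schwarz (hz n) hd.
  have [_ zK _] := Hz n.
  have h3 := Hw n.+1.
  have h4 := nmB (l2_ip (z n) w) (l2_ip (z n) (w - W n.+1)).
  rewrite -(ipBr (hz n) hw hd) subKr in h4.
  have h5 : l2n (z n) * l2n (w - W n.+1) <= n.+1%:R / 3.
    rewrite zK; have h6 := ler_wpM2l (ltW (Kn0 n)) h3; apply: (le_trans h6).
    rewrite -/(p n.+1) pS /Kn le_eqVlt; apply/orP; left; apply/eqP; field.
    by rewrite gt_eqF.
  rewrite /= in h1; lra.
have := archi_boundP (l2n_ge0 x); set N := Num.bound _ => HN.
have N0 : 0 <= N%:R :> R by rewrite ler0n.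
(* At index 2 N the lower bound 2/3 (2 N + 1) exceeds N, which exceeds [l2n x]. *)
have L1 := Lx N.*2; rewrite -addnn -(natr1 (N + N)) natrD in L1; lra.
Qed.

(* [T G + t] is bounded below on the image of [T], uniformly in [t >= 0]; it is
   onto for large [t], and surjectivity propagates down to [t = 0] by steps of
   fixed length. *)
Lemma im_adjoint_surjective T G : l2_linear T -> l2_bounded T -> l2_adjoint T G ->
  l2_closed (l2_im T) ->
  forall v, l2_im T v -> exists2 w, l2_im T w & T (G w) = v.
Proof.
move=> Tl Tb TG Tc; have [Tm TD Ta] := Tl.
have Gl := l2_adjoint_linear Tm TG; have [Gm GD Ga] := Gl.
have Gb := l2_adjoint_bounded Tm TG Tb.
have GT := l2_adjoint_sym Tm TG.
have Ms := l2_im_submodule Tl; have [Ml M0 MD Ma] := Ms.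
have [d d0 Hd] := adjoint_bounded_below Tl TG Tc.
set M := l2_im T in Ms Ml M0 MD Ma Tc Hd *.
have Sl := l2_linear_comp Tl Gl.
have /l2_boundedP[C C0 HC] := l2_bounded_comp Gm Tb Gb.
pose S t w := T (G w) + l2_act w (cst t).
have SE t s w : S t w - S s w = l2_act w (cst (t - s)).
  rewrite /S opprD addrACA subrr add0r cstB l2_actD; congr (_ + _).
  by apply/funext => i; rewrite [LHS]/(- _) /l2_act !cmulE mulrN.
have SM t w : M w -> M (S t w).
  move=> Mw; apply: MD; last exact: Ma.
  by exists (G w) => //; apply: Gm; exact: Ml.
have Slin t : l2_linear (S t).
  split=> [x hx|x y hx hy|x a hx].
  - by apply: l2D; [apply: Tm; exact: Gm|exact: l2_actP].
  - have [_ SD _] := Sl; have := SD _ _ hx hy; rewrite /= => e1.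
    by rewrite /S e1 l2_actDl addrACA.
  - have [_ _ Sa] := Sl; have := Sa _ a hx; rewrite /= => e1.
    by rewrite /S e1 l2_actDl !l2_actA cstC.
have Sb t x : 0 <= t -> l2 A x -> l2n (S t x) <= (C + t) * l2n x.
  move=> t0 hx; have hx' := l2_actP (a := cst t) hx.
  have h := l2nD (Tm _ (Gm _ hx)) hx'; have h' := HC _ hx.
  rewrite l2n_cst// ger0_norm// in h; rewrite /= in h'.
  by rewrite /S (le_trans h)// mulrDl lerD2r.
(* (w, S t w) = (G w, G w) + t (w, w). The last term is positive, so the norm is at least |G w|^2 >=
   d^2 |w|^2, whatever t >= 0 is. *)
have low t w : 0 <= t -> M w -> d ^+ 2 * l2n w <= l2n (S t w).
  move=> t0 Mw; have hw := Ml _ Mw; have hG := Gm _ hw; have hT := Tm _ hG.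
  have [->|w0] := eqVneq (l2n w) 0; first by rewrite mulr0 l2n_ge0.
  have wp : 0 < l2n w by rewrite lt_neqAle eq_sym w0 l2n_ge0.
  have hS : l2 A (S t w) by have [Sm _ _] := Slin t; exact: Sm.
  rewrite -(ler_pM2l wp); apply: le_trans (ip_cauchy_schwarz hw hS).
  rewrite /S ipDr//; last exact: l2_actP.
  rewrite ip_actr// -GT.2// -cstC.
  apply: le_trans (pos_le_nmD (pos_ip hG) (pos_cstM t0 (pos_ip hw))).
  rewrite -l2n_sqr mulrCA -expr2 -exprMn ler_sqr ?nnegrE ?l2n_ge0 ?mulr_ge0 ?(ltW d0) ?l2n_ge0//.
  exact: Hd.
pose P t := forall v, M v -> exists2 w, M w & S t w = v.
have h0 : 0 < d ^+ 2 / 2 by rewrite divr_gt0// exprn_gt0.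
have d20 : 0 < d ^+ 2 by rewrite exprn_gt0.
(* The solution w at t + d^2 / 2 has |w| <= |v| / d^2. Its residual at t is (d^2 / 2) w, of norm at
   most |v| / 2, which is the factor [approx_surjective] asks for. *)
have down t : 0 <= t -> P (t + d ^+ 2 / 2) -> P t.
  move=> t0 Pt; have t1 : 0 <= t + d ^+ 2 / 2 by rewrite addr_ge0// ltW.
  apply: (approx_surjective (C := C + t) (K := (d ^+ 2)^-1) Ms Tc (Slin t) (SM t)).
  - exact: addr_ge0.
  - by move=> x; exact: Sb.
  - by rewrite invr_ge0 ltW.
  move=> v Mv; have [w Mw Sw] := Pt v Mv; exists w.
  have lw : l2n w <= (d ^+ 2)^-1 * l2n v.
    by rewrite ler_pdivlMl// -Sw low.
  split=> //; rewrite -Sw SE l2n_cst; last exact: Ml.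
  rewrite addrAC subrr add0r ger0_norm; last exact: ltW.
  rewrite Sw; have h := ler_wpM2l (ltW h0) lw; rewrite (le_trans h)//.
  by rewrite le_eqVlt; apply/orP; left; apply/eqP; field; rewrite gt_eqF.
(* The approximate solution v / t leaves the residual - T G v / t, of norm at most (C / t) |v| <=
   |v| / 2. *)
have Plarge t : 0 < t -> 2 * C <= t -> P t.
  move=> t0 Ct.
  apply: (approx_surjective (C := C + t) (K := t^-1) Ms Tc (Slin t) (SM t)).
  - by rewrite addr_ge0// ltW.
  - by move=> x; apply: Sb; exact: ltW.
  - by rewrite invr_ge0 ltW.
  move=> v Mv; have hv := Ml _ Mv.
  have Mw : M (l2_act v (cst t^-1)) by exact: Ma.
  have hw := Ml _ Mw.
  have nw : l2n (l2_act v (cst t^-1)) = t^-1 * l2n v.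
    by rewrite l2n_cst// ger0_norm// invr_ge0 ltW.
  exists (l2_act v (cst t^-1)); split => //; first by rewrite nw.
  have -> : v - S t (l2_act v (cst t^-1)) = - T (G (l2_act v (cst t^-1))).
    rewrite /S l2_actA -cstM mulVf ?gt_eqF// cst1 l2_act1 opprD addrC.
    by rewrite subrK.
  rewrite l2nN; last by apply: Tm; exact: Gm.
  have h := HC _ hw; rewrite /= nw in h; rewrite (le_trans h)//.
  rewrite mulrA ler_wpM2r ?l2n_ge0// ler_pdivrMr//; lra.
have P0 n : P (n%:R * (d ^+ 2 / 2)) -> P 0.
  elim: n => [|n IH]; first by rewrite mul0r.
  rewrite -natr1 mulrDl mul1r => /down h; apply: IH; apply: h.
  by rewrite mulr_ge0// ltW.
have P00 : P 0.
  have q0 : 0 <= 2 * C / (d ^+ 2 / 2) by rewrite divr_ge0 ?mulr_ge0// ltW.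
  have := archi_boundP q0; set N := Num.bound _ => HN.
  have Np : 0 < N%:R :> R by exact: le_lt_trans HN.
  apply: (P0 N); apply: Plarge; first by rewrite mulr_gt0.
  by rewrite ltW// -ltr_pdivrMr.
move=> v Mv; have [w Mw <-] := P00 v Mv; exists w => //.
rewrite /S cst0 (_ : l2_act w 0 = 0) ?addr0//.
by apply/funext => i; exact: mulr0.
Qed.

Lemma closed_im_complement T z : bounded_adjointable T -> l2_closed (l2_im T) ->
  l2 A z -> exists w u, [/\ l2_im T w, l2_orth (l2_im T) u & z = w + u].
Proof.
move=> [Tl Tb [G TG]] Tc hz.
have [Tm _ _] := Tl; have Gl := l2_adjoint_linear Tm TG.
have [Gm _ _] := Gl.
have [|w Mw e1] := im_adjoint_surjective Tl Tb TG Tc (v := T (G z)).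
  by exists (G z) => //; exact: Gm.
have hw : l2 A w by have [x hx <-] := Mw; exact: Tm.
have hu := l2B hz hw; have hGu := Gm _ hu; have hTu := Tm _ hGu.
exists w, (z - w); split => //; last by rewrite addrC subrK.
(* For u = z - w, T G u = 0 gives (G u, G u) = (T G u, u) = 0. *)
have Gu0 : G (z - w) = 0.
  apply: ip_eq0 => //; rewrite -TG.2//.
  have Sl := l2_linear_comp Tl Gl.
  by rewrite -[T (G _)]/((T \o G) _) l2_linearB//= e1 subrr ip0l.
by split=> // _ [x hx <-]; rewrite TG.2// Gu0 ip0r.
Qed.

(** For the adjoint E of D, solving D E w = D z puts z - E w in the kernel, and the range of E is
    orthogonal to the kernel. *)
Lemma ker_complement D z : bounded_adjointable D -> l2_closed (l2_im D) ->
  l2 A z -> exists k u, [/\ l2_ker D k, l2_orth (l2_ker D) u & z = k + u].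
Proof.
move=> [Dl Db [E DE]] Dc hz.
have [Dm _ _] := Dl; have [Em _ _] := l2_adjoint_linear Dm DE.
have [|w Mw e1] := im_adjoint_surjective Dl Db DE Dc (v := D z); first by exists z.
have hw : l2 A w by have [x hx <-] := Mw; exact: Dm.
have hE := Em _ hw.
exists (z - E w), (E w); split; last by rewrite subrK.
- by split; [exact: l2B|rewrite l2_linearB// e1 subrr].
- by split=> // k [hk k0]; rewrite -DE.2// k0 ip0l.
Qed.
End ClosedRange.

Theorem lemma3p13 (R : realType) (A : cstarAlgType R) (F D : A ^nat -> A ^nat)
    (hF : bounded_adjointable F) (hD : bounded_adjointable D)
    (hFc : l2_closed (l2_im F)) (hDc : l2_closed (l2_im D))
    (hs : l2_closed (l2_sum (l2_im F) (l2_ker D))) :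
  orthogonally_complementable (l2_sum (l2_im F) (l2_ker D)).
Proof.
set N := l2_sum _ _ in hs *.
have [Fl Fb [G FG]] := hF; have [Dl _ _] := hD.
have [Fm FD Fa] := Fl; have [Dm DD Da] := Dl.
have kerD : l2_submodule (l2_ker D).
  split=> [x [] //||x y [hx x0] [hy y0]|x a [hx x0]].
  - by split; [exact: l2_0|exact: l2_linear0].
  - by split; [exact: l2D|rewrite DD// x0 y0 addr0].
  - split; first exact: l2_actP.
    by rewrite Da// x0; apply/funext => i; exact: mul0r.
have [imFl imF0 imFD imFa] := l2_im_submodule Fl.
have [Kl K0 KD Ka] := kerD.
have Nl : N `<=` l2 A.
  by move=> _ [x Mx [y Ky <-]]; apply: l2D; [exact: imFl|exact: Kl].
have Ns : l2_submodule N.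
  split => //.
  - by exists 0 => //; exists 0 => //; rewrite addr0.
  - move=> _ _ [x Mx [y Ky <-]] [x' Mx' [y' Ky' <-]].
    by exists (x + x'); [exact: imFD|exists (y + y'); [exact: KD|rewrite addrACA]].
  - move=> _ a [x Mx [y Ky <-]]; exists (l2_act x a); first exact: imFa.
    by exists (l2_act y a); [exact: Ka|rewrite l2_actDl].
(* P is the projection onto the complement of ker D, with arbitrary values outside [l2]. Its
   linearity comes from being its own adjoint. *)
have /choice[P HP] : forall x, exists u, l2 A x -> l2_ker D (x - u) /\ l2_orth (l2_ker D) u.
  move=> x; have [hx|nx] := pselect (l2 A x); last by exists 0.
  have [k [u [Kk Ou ->]]] := ker_complement hD hDc hx.
  by exists u => _; rewrite addrK.
have Pm x : l2 A x -> l2 A (P x) by move=> /HP[_ []].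
have PK x : l2 A x -> l2_ker D (x - P x) by move=> /HP[].
have PO x k : l2 A x -> l2_ker D k -> l2_ip k (P x) = 0.
  by move=> /HP[_ [_ H]] Kk; exact: H.
have PO' x k : l2 A x -> l2_ker D k -> l2_ip (P x) k = 0.
  by move=> hx Kk; rewrite -(ip_star (Kl _ Kk) (Pm _ hx)) PO// star0.
have Pker k : l2_ker D k -> P k = 0.
  move=> Kk; have hk := Kl _ Kk; have hP := Pm _ hk.
  apply: ip_eq0 => //; apply: PO => //.
  by rewrite -[P k](subKr k); apply: submoduleB => //; exact: PK.
have Porth u : l2_orth (l2_ker D) u -> P u = u.
  move=> [hu Ou]; have hP := Pm _ hu; have Kd := PK _ hu; have hd := Kl _ Kd.
  apply/esym/eqP; rewrite -subr_eq0; apply/eqP; apply: ip_eq0 => //.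
  by rewrite ipBr// Ou// PO// subrr.
have Psa : l2_adjoint P P.
  split=> // x y hx hy; have [hPx hPy] := (Pm _ hx, Pm _ hy).
  have h1 := ipBr hPx hy hPy; rewrite PO' in h1; [|by []|exact: PK].
  have h2 := ipBl hx hPx hPy; rewrite PO in h2; [|by []|exact: PK].
  by apply/eqP; rewrite -subr_eq0 -{1}(subrK (l2_ip (P x) (P y)) (l2_ip (P x) y)) -h1 add0r -opprB -h2 oppr0.
have Pl : l2_linear P by exact: l2_adjoint_linear Psa.
have Pb : l2_bounded P.
  apply/l2_boundedP; exists 1 => // x hx; rewrite mul1r.
  have hPx := Pm _ hx.
  have [->|n0] := eqVneq (l2n (P x)) 0; first exact: l2n_ge0.
  have np : 0 < l2n (P x) by rewrite lt_neqAle eq_sym n0 l2n_ge0.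
  rewrite -(ler_pM2l np) -expr2 l2n_sqr.
  have h1 := ipBr hPx hx hPx; rewrite PO' in h1; [|by []|exact: PK].
  move/esym/eqP : h1; rewrite subr_eq0 => /eqP <-.
  exact: ip_cauchy_schwarz.
have hPF : bounded_adjointable (P \o F).
  split; [exact: l2_linear_comp|exact: l2_bounded_comp|].
  by exists (G \o P); exact: l2_adjoint_comp.
have PFc : l2_closed (l2_im (P \o F)).
  move=> x hx Hx.
  have Hx' e : (0 < e)%R -> exists2 y, l2_im (P \o F) y & l2n (x - y) < e.
    move=> e0; have [|y My h] := Hx e%:C; first by rewrite ltcR.
    by exists y => //; rewrite -ltcR -l2_normE.
  have imN y : l2_im (P \o F) y -> N y.
    move=> [z hz <-] /=; exists (F z); first by exists z.
    (* P F z differs from F z by an element of ker D. *)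
    exists (- (F z - P (F z))); last by rewrite opprB addrC subrK.
    rewrite -[- _]sub0r; apply: submoduleB => //; apply: PK; exact: Fm.
  have Nx : N x.
    by apply: closed_real => // e /Hx'[y /imN Ny h]; exists y.
  have Ox : l2_orth (l2_ker D) x.
    split=> // k Kk; have hk := Kl _ Kk; apply: nm_le0; apply/ler_addgt0Pr => e e0.
    have k1 : 0 < l2n k + 1 by rewrite ltr_wpDl// l2n_ge0.
    have [y [z hz yz] h] := Hx' _ (divr_gt0 e0 k1).
    have hFz := Fm _ hz.
    have hy : l2 A y by rewrite -yz; exact: Pm.
    have -> : l2_ip k x = l2_ip k (x - y).
      by rewrite ipBr// -yz /= PO// subr0.
    have h1 := ip_cauchy_schwarz hk (l2B hx hy).
    have h2 := l2n_ge0 k; have h3 := l2n_ge0 (x - y).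
    rewrite ltr_pdivlMr// in h; nra.
  (* The limit is x = F z + k with k in ker D, and it is fixed by P because it is orthogonal to ker
     D; so x = P F z. *)
  rewrite -(Porth _ Ox); have [_ [z hz <-] [k Kk <-]] := Nx.
  exists z => //=; have [_ PD _] := Pl.
  by rewrite (PD _ _ (Fm _ hz) (Kl _ Kk)) (Pker _ Kk) addr0.
split => //.
- apply/seteqP; split.
    by move=> _ [x Nx [y [hy _] <-]]; apply: l2D => //; exact: Nl.
  move=> z hz; have [_ [u [[x hx <-] [hu Ou] ->]]] := closed_im_complement hPF PFc hz.
  have hFx := Fm _ hx; have hPu := Pm _ hu; have hPFx := Pm _ hFx.
  (* This is P F x + (u - P u), rewritten as F x plus an element of ker D. *)
  exists (F x + ((u - P u) - (F x - P (F x)))).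
    exists (F x); first by exists x.
    by exists ((u - P u) - (F x - P (F x))) => //; apply: submoduleB => //; exact: PK.
  exists (P u).
    split=> // _ [_ [y hy <-] [k Kk <-]].
    have hFy := Fm _ hy; have hk := Kl _ Kk.
    rewrite ipDl// (PO u k)// addr0 -Psa.2//; apply: Ou; by exists y.
  by rewrite /= opprB addrCA (addrCA (F x)) subrr addr0 addrAC subrK addrC.
- apply/seteqP; split; last first.
    move=> _ ->; split; first by have [] := Ns.
    by split=> [|x Nx]; [exact: l2_0|rewrite ip0r//; exact: Nl].
  by move=> x [Nx [hx Ox]]; apply: ip_eq0 => //; exact: Ox.
Qed.
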